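(* Let $G$ be a $d$-step nilpotent Lie group and $\Gamma<G$ a discrete cocompact subgroup. Let $g\in G$, let $U\subset G/\Gamma$ be an open neighbourhood of $e\Gamma$, and let $(n_i)_{i=1}^\infty$ be a sequence of positive integers. Then there exists $\alpha\in\mathcal S_{k}$ with $k=\binom{d+1}{2}$ such that $g^{n_\alpha}\Gamma\in U$. Equivalently: every Nil$_d$-Bohr$_0$ set is an SG$_k^*$ set for every $k\ge\binom{d+1}{2}$.
   Context: $\mathbb N=\{1,2,\dots\}$; $\mathscr F$ is the family of finite non-empty subsets of $\mathbb N$. For $k\ge0$, $\mathcal S_k\subset\mathscr F$ is the family of $\alpha\in\mathscr F$ such that for every $i\in\alpha$, either $i=\max\alpha$ or there is $j\in\alpha$ with $i<j\le i+k$ (gaps bounded by $k$). For a sequence $(n_i)$ and $\alpha\in\mathscr F$, $n_\alpha=\sum_{i\in\alpha}n_i$. A set $B\subset\mathbb N$ is SG$_k^*$ if for every sequence $(n_i)$ of positive integers there is $\alpha\in\mathcal S_k$ with $n_\alpha\in B$. A set $A\subset\mathbb N$ is Nil$_d$-Bohr$_0$ if it contains a non-empty set of the form $\{n\in\mathbb N: g^n\Gamma\in U\}$ where $G$ is a $d$-step nilpotent Lie group, $\Gamma<G$ is discrete with $G/\Gamma$ compact, $g\in G$, and $U\subset G/\Gamma$ is open with $e\Gamma\in U$. *)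

(* Defs.v *)
From HB Require Import structures.
From mathcomp Require Import all_boot all_order all_algebra.
From mathcomp Require Import all_classical all_reals all_analysis.
From mathcomp Require Import Rstruct Rstruct_topology.

Set Implicit Arguments.
Unset Strict Implicit.
Unset Printing Implicit Defensive.

Import Order.TTheory GRing.Theory Num.Theory.
Import numFieldNormedType.Exports.
Local Open Scope classical_set_scope.
Local Open Scope ring_scope.

Notation RR := Rdefinitions.R.

Fixpoint iterD (p m : nat) (vs : seq 'rV[RR]_p) (f : 'rV[RR]_p -> 'rV[RR]_m)
  : 'rV[RR]_p -> 'rV[RR]_m :=
  match vs with
  | [::] => f
  | v :: vs' => fun x => derive (iterD vs' f) x v
  end.

Definition smooth_on (p m : nat) (O : set 'rV[RR]_p) (f : 'rV[RR]_p -> 'rV[RR]_m) :=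
  forall vs : seq 'rV[RR]_p,
    (forall x v, O x -> derivable (iterD vs f) x v) /\
    (forall x, O x -> {for x, continuous (iterD vs f)}).

Record chart (T : topologicalType) (n : nat) := Chart {
  ch_dom : set T;
  ch_fwd : T -> 'rV[RR]_n;
  ch_bwd : 'rV[RR]_n -> T }.

Definition is_chart (T : topologicalType) (n : nat) (c : chart T n) :=
  [/\ open (ch_dom c),
      open (ch_fwd c @` ch_dom c),
      (forall x, ch_dom c x -> ch_bwd c (ch_fwd c x) = x),
      (forall x, ch_dom c x -> {for x, continuous (ch_fwd c)}) &
      (forall y, (ch_fwd c @` ch_dom c) y -> {for y, continuous (ch_bwd c)})].

Definition chart_img (T : topologicalType) (n : nat) (c : chart T n) :=
  ch_fwd c @` ch_dom c.

Definition smooth_atlas (T : topologicalType) (n : nat) (A : set (chart T n)) :=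
  [/\ (forall c, A c -> is_chart c),
      (forall x, exists2 c, A c & ch_dom c x) &
      (forall a b, A a -> A b ->
         smooth_on (ch_fwd a @` (ch_dom a `&` ch_dom b))
                   (fun y => ch_fwd b (ch_bwd a y)))].

Definition is_group (T : Type) (mul : T -> T -> T) (inv : T -> T) (e : T) :=
  [/\ (forall x y z, mul x (mul y z) = mul (mul x y) z),
      (forall x, mul e x = x), (forall x, mul x e = x),
      (forall x, mul (inv x) x = e) & (forall x, mul x (inv x) = e)].

Definition lie_group (T : topologicalType) (mul : T -> T -> T) (inv : T -> T) (e : T) :=
  [/\ hausdorff_space T,
      is_group mul inv e,
      continuous (fun p : T * T => mul p.1 p.2),
      continuous inv &
      exists n (A : set (chart T n)),
        [/\ smooth_atlas A,
            (forall a b c, A a -> A b -> A c ->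
               smooth_on
                 [set z : 'rV[RR]_(n + n) | chart_img a (lsubmx z) /\
                    chart_img b (rsubmx z) /\
                    ch_dom c (mul (ch_bwd a (lsubmx z)) (ch_bwd b (rsubmx z)))]
                 (fun z => ch_fwd c (mul (ch_bwd a (lsubmx z)) (ch_bwd b (rsubmx z))))) &
            (forall a c, A a -> A c ->
               smooth_on [set y | chart_img a y /\ ch_dom c (inv (ch_bwd a y))]
                         (fun y => ch_fwd c (inv (ch_bwd a y))))]].

Definition subgroup (T : Type) (mul : T -> T -> T) (inv : T -> T) (e : T) (H : set T) :=
  [/\ H e, (forall x y, H x -> H y -> H (mul x y)) & (forall x, H x -> H (inv x))].

Definition gen (T : Type) (mul : T -> T -> T) (inv : T -> T) (e : T) (S : set T) : set T :=
  fun z => forall H, subgroup mul inv e H -> S `<=` H -> H z.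

Definition commutator (T : Type) (mul : T -> T -> T) (inv : T -> T) (x y : T) :=
  mul (mul (inv x) (inv y)) (mul x y).

Fixpoint lcs (T : Type) (mul : T -> T -> T) (inv : T -> T) (e : T) (i : nat) : set T :=
  match i with
  | 0 => setT
  | i'.+1 => gen mul inv e
      [set z | exists x y, lcs mul inv e i' y /\ z = commutator mul inv x y]
  end.

(* d-step nilpotent: G_{d+1} = [G,[G,...,G]] (d commutators) is trivial *)
Definition nilpotent_step (T : Type) (mul : T -> T -> T) (inv : T -> T) (e : T) (d : nat) :=
  lcs mul inv e d = [set e].

Definition discrete_subgroup (T : topologicalType) (mul : T -> T -> T) (inv : T -> T)
  (e : T) (Gam : set T) :=
  subgroup mul inv e Gam /\
  (forall x, Gam x -> exists O : set T, [/\ open O, O x & O `&` Gam = [set x]]).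

Definition saturated (T : Type) (mul : T -> T -> T) (Gam : set T) (O : set T) :=
  forall x y, O x -> Gam y -> O (mul x y).

(* G/Gam (with the quotient topology) is compact.  Open subsets of G/Gam are
   exactly the images of open Gam-saturated subsets of G, so this is literally
   compactness of the quotient space. *)
Definition cocompact (T : topologicalType) (mul : T -> T -> T) (Gam : set T) :=
  forall (I : Type) (O : I -> set T),
    (forall i, open (O i) /\ saturated mul Gam (O i)) ->
    (forall x, exists i, O i x) ->
    exists s : seq I, forall x, exists i, List.In i s /\ O i x.

Definition gpow (T : Type) (mul : T -> T -> T) (e : T) (g : T) (n : nat) : T :=
  iter n (mul g) e.

Definition finset_pos (alpha : seq nat) :=
  [/\ uniq alpha, alpha != [::] & all (fun i => 0 < i)%N alpha].

Definition in_S (k : nat) (alpha : seq nat) :=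
  finset_pos alpha /\
  forall i, i \in alpha ->
    i = (\max_(j <- alpha) j)%N \/ exists2 j, j \in alpha & (i < j <= i + k)%N.

Definition n_sum (n : nat -> nat) (alpha : seq nat) : nat := (\sum_(i <- alpha) n i)%N.

(* Main.v *)
Require Import Defs.
From HB Require Import structures.
From mathcomp Require Import all_boot all_order all_algebra.
From mathcomp Require Import all_classical all_reals all_analysis.
From mathcomp Require Import Rstruct Rstruct_topology lra.
Set Implicit Arguments.
Unset Strict Implicit.
Unset Printing Implicit Defensive.
Local Open Scope classical_set_scope.

(** Write X = G/Gam and let T be translation by g.  Split the positive integers
    into d residue classes; a set alpha of bounded gaps d arises by switching
    classes on and off so that at least one of them is on between the beginning
    and the end of alpha.  Let b_r and a_r be the limits, along one ultrafilter,
    of the powers of T that record switching class r on and off at a late time.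
    Then T^(n_alpha) approximates every product of such limits along a path of
    non-empty states, and it suffices that x0 = b_0 w a_0 x0 for a path w from
    {0} to {0}.

    The a_r and b_r act on the faces of the closed set of (d+1)-cubes
    (T^(n . eps) x).  In a d-step nilmanifold all vertices of a cube but one
    determine the last one.  Hence the maps acting on faces form a group (their
    idempotents are trivial, by Ellis's lemma), and a map acting on all faces of
    the same side at once is the identity.  Now z_0 = b_0^-1 a_0^-1 acts on faces
    of codimension two, so the commutators z_(j+1) = [b_(j+1), z_j] end with
    z_(d-1) = 1.  As z_j is a legal path between states that contain 0 and a
    class above j, going down from z_(d-1) = 1 shows that w = z_0 is legal.  Thus
    d classes suffice, and d <= binom(d+1, 2).

    Uniqueness of cube completion needs a filtration N_1 = G, N_(d+1) = 1 modulo
    which Gam stays discrete.  The stability group of the upper central series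
    is one, because a nilpotent Lie group has no small subgroups, also modulo
    its upper central series, and lattices in it are Noetherian. *)

Section Dynamics.
Import Order.TTheory GRing.Theory Num.Theory.
Local Open Scope ring_scope.

(** * Recurrence along sets with bounded gaps *)

Section Ellis.
Variables (X : topologicalType).
Hypothesis hX : hausdorff_space X.
Hypothesis cX : compact [set: X].

(** One operator [L] chooses limits for all functions at once, so the pointwise limit of a family
    [v] of maps is [fun x => L (fun i => v i x)]. *)
Lemma ultra_limit (I : Type) (F : set_system I) : UltraFilter F ->
  exists L : (I -> X) -> X, forall f, f @ F --> L f.
Proof.
move=> FU; have FP : ProperFilter F by exact: ultra_proper.
suff : forall f : I -> X, exists x : X, f @ F --> (x : X) by move=> ex; have [L LP] := choice ex; exists L.
move=> f; have [x [_ fx]] := cX (fmap_proper_filter f FP) filterT.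
exists x => U /= Ux; have [//|FC] := in_ultra_setVsetC (f @^-1` U) FU.
by have [y [ny Uy]] := fx (~` U) U FC Ux.
Qed.

(* closed for the topology of pointwise convergence *)
Definition uclosed (S : set (X -> X)) := forall (I : Type) (F : set_system I)
  (v : I -> X -> X) u, UltraFilter F -> (\forall i \near F, S (v i)) ->
  (forall x, (fun i => v i x) @ F --> u x) -> S u.

Definition comp_closed (S : set (X -> X)) := forall u v, S u -> S v -> S (u \o v).

Lemma uclosedI S S' : uclosed S -> uclosed S' -> uclosed (S `&` S').
Proof.
move=> cS cS' I F v u FU Fv vu; have FP : ProperFilter F by exact: ultra_proper.
by split; [apply: (cS I F v)|apply: (cS' I F v)] => //; apply: filterS Fv => i [].
Qed.

(** Preimages in [S] are chosen along the ultrafilter and their pointwise limit stays in [S].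
    Composition with [u] on the right respects pointwise limits even when [u] is not continuous. *)
Lemma uclosed_comp_image S u : S !=set0 -> uclosed S -> uclosed [set s \o u | s in S].
Proof.
move=> [s0 Ss0] cS I F v w FU Fv vw.
have FP : ProperFilter F by exact: ultra_proper.
(* [s0] is a default value for the indices where [v i] is outside the image; they are negligible for
   [F]. *)
have ex i : exists s, S s /\ ([set s \o u | s in S] (v i) -> v i = s \o u).
  have [[s Ss sv]|ni] := pselect ([set s \o u | s in S] (v i)).
    by exists s; split.
  by exists s0; split.
have [g gP] := choice ex.
have [L LP] := ultra_limit FU.
exists (fun x => L (fun i => g i x)).
  apply: (cS I F g) => //.
  by apply: filterE => i; have [] := gP i.
apply/funext => x /=; apply: (cvg_unique hX) (vw x).
have := LP (fun i => g i (u x)); apply: cvg_trans; apply: near_eq_cvg.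
by apply: filterS Fv => i /(gP i).2 ->.
Qed.

(** Zorn's lemma yields a minimal closed subsemigroup [B]. For [u] in [B], minimality gives first
    [B \o u = B], and then [t \o u = u] for every [t] in [B], in particular for [t = u]. *)
Lemma ellis_idempotent S : S !=set0 -> uclosed S -> comp_closed S ->
  exists2 u, S u & u \o u = u.
Proof.
move=> S0 cS mS.
pose good B := [/\ B `<=` S, B !=set0, uclosed B & comp_closed B].
pose T := {B | good B}.
have gS : good S by split.
pose R (A B : T) := `[< sval B `<=` sval A >].
have [|||[B gB] Bmin] := @ZL_preorder T (exist _ S gS) R.
- by move=> t; exact/asboolP.
- by move=> r s t /asboolP rs /asboolP st; apply/asboolP => x /st /rs.
- move=> C Ctot; have [[B0 CB0]|nC] := pselect (exists B, C B); last first.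
    by exists (exist _ S gS) => B CB; exfalso; apply: nC; exists B.
  pose F0 := filter_from C sval.
  have F0P : ProperFilter F0.
    apply: filter_from_proper; last by move=> [A [? ? ? ?]].
    apply: filter_from_filter; first by exists B0.
    move=> A B CA CB; have [/asboolP AB|/asboolP BA] := Ctot A B CA CB.
      by exists B => // x Bx; split=> //; exact: AB.
    by exists A => // x Bx; split=> //; exact: BA.
  have [F [FU F0F]] := ultraFilterLemma F0P.
  have FP : ProperFilter F by exact: ultra_proper.
  have [L LP] := ultra_limit FU.
  pose D := \bigcap_(B in C) sval B.
  have gD : good D.
    split.
    - by move=> u /(_ B0 CB0); have [+ _ _ _] := svalP B0; apply.
    - exists (fun x => L (fun v => v x)) => B CB; have [_ _ cB _] := svalP B.
      apply: (cB _ F id _ FU); last by move=> x; exact: LP.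
      by apply: F0F; exists B.
    - move=> I E v u EU Ev vu B CB; have [_ _ cB _] := svalP B.
      have EP : ProperFilter E by exact: ultra_proper.
      by apply: (cB _ E v u EU _ vu); apply: filterS Ev => i Di; exact: Di.
    - by move=> u v Du Dv B CB; have [_ _ _] := svalP B; apply; [exact: Du|exact: Dv].
  by exists (exist _ D gD) => B CB; apply/asboolP => u /= /(_ B CB).
have [BS [u Bu] cB mB] := gB.
have min B' : good B' -> B' `<=` B -> B' = B.
  move=> gB' B'B; apply/seteqP; split=> //.
  by have /asboolP := Bmin (exist _ B' gB') (asboolT B'B).
have Bu' : [set s \o u | s in B] = B.
  apply: min; last by move=> _ [s Bs <-]; exact: mB.
  split.
  - by move=> _ [s Bs <-]; apply: BS; exact: mB.
  - by exists (u \o u), u.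
  - by apply: uclosed_comp_image => //; exists u.
  - move=> _ _ [s Bs <-] [t Bt <-]; exists (s \o u \o t) => //.
    by apply: (mB) => //; exact: mB.
have : B u by [].
rewrite -{1}Bu' => -[s Bs su].
have /seteqP[_ BW] : B `&` [set t : X -> X | t \o u = u] = B.
  apply: min; last by move=> t [].
  split.
  - by move=> t [/BS].
  - by exists s.
  - apply: uclosedI => // I E v w EU Ev vw; apply/funext => x /=.
    have EP : ProperFilter E by exact: ultra_proper.
    apply: (cvg_unique hX) (vw (u x)) _.
    apply: (@cvg_trans _ ((fun=> u x) @ E)); last exact: cvg_cst.
    by apply: near_eq_cvg; apply: filterS Ev => i /(congr1 (@^~ x)) /= ->.
  - move=> a b [Ba ua] [Bb ub]; split; first exact: mB.
    by rewrite /= -compA ub.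
by exists u; [exact: BS|have [] := BW u Bu].
Qed.

End Ellis.

(** * Maps acting on faces of cubes, and paths of states *)

Section Recurrence.
Variables (X : topologicalType) (A : int -> X -> X) (k' : nat) (Q : set (seq bool -> X)).
Let k := k'.+1.
Let n := k.+1.
Hypothesis hX : hausdorff_space X.
Hypothesis cX : compact [set: X].
Hypothesis A0 : forall x, A 0 x = x.
Hypothesis AD : forall a b x, A (a + b) x = A a (A b x).
Hypothesis Ac : forall z, continuous (A z).
Hypothesis Qcst : forall x, Q (fun=> x).
Hypothesis Qface : forall i b z y, (i < n)%N -> Q y ->
  Q (fun w => if nth false w i == b then A z (y w) else y w).
Hypothesis Qclosed : forall y, (forall U : seq bool -> set X,
    (forall w, nbhs (y w) (U w)) ->
    exists2 y', Q y' & forall w, size w = n -> U w (y' w)) -> Q y.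
Hypothesis Quniq : forall y x, Q y ->
  (forall w, size w = n -> w <> nseq n true -> y w = x) -> y (nseq n true) = x.

Definition onface i b (u : X -> X) y : seq bool -> X :=
  fun w => if nth false w i == b then u (y w) else y w.

Lemma Q_ext y y' : (forall w, size w = n -> y w = y' w) -> Q y -> Q y'.
Proof.
move=> yy' Qy; apply: Qclosed => U Uy; exists y => // w wn.
by rewrite yy'//; exact: nbhs_singleton.
Qed.

Lemma Q_limit (I : Type) (F : set_system I) (Y : I -> seq bool -> X) y :
  ProperFilter F -> (\forall i \near F, Q (Y i)) ->
  (forall w, (fun i => Y i w) @ F --> y w) -> Q y.
Proof.
move=> FP QY Yy; apply: Qclosed => U Uy.
(* A cube has finitely many vertices, so one index serves all of them. *)
have : \forall i \near F, forall w, w \in [seq val t | t <- enum {: n.-tuple bool}] ->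
    U w (Y i w).
  elim: [seq val t | t <- _] => [|w s IH]; first exact: filterE.
  have Yw : \forall i \near F, U w (Y i w) by exact: (Yy w _ (Uy w)).
  apply: filterS2 Yw IH => i Uw Us v.
  by rewrite inE => /orP[/eqP->|/Us].
move=> UY; have [i [QYi Ui]] := filter_ex (filterI QY UY).
exists (Y i) => // w wn; apply: Ui.
by apply/mapP; exists (Tuple (introT eqP wn)) => //; rewrite mem_enum.
Qed.

(* This is a group in which commutators are controlled by [corner] below. *)
Definition facegp : set (X -> X) :=
  [set u | forall i b, (i < n)%N -> forall y, Q y -> Q (onface i b u y)].

Lemma facegp_uclosed : uclosed facegp.
Proof.
move=> I F v u FU Fv vu i b ni y Qy.
have FP : ProperFilter F by exact: ultra_proper.
apply: (@Q_limit I F (fun j => onface i b (v j) y)).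
  by apply: filterS Fv => j; exact.
by move=> w; rewrite /onface; case: eqP => _; [exact: vu|exact: cvg_cst].
Qed.

Lemma facegp_comp : comp_closed facegp.
Proof.
move=> u v Gu Gv i b ni y Qy; have := Gu i b ni _ (Gv i b ni _ Qy).
by apply: Q_ext => w _; rewrite /onface; case: eqP.
Qed.

Lemma facegp_A z : facegp (A z).
Proof. by move=> i b ni y; exact: Qface. Qed.

Lemma all_bits w : size w = n -> all (nth false w) (iota 0 n) = (w == nseq n true).
Proof.
move=> wn; apply/allP/eqP => [al|-> i].
  apply: (@eq_from_nth _ false); first by rewrite size_nseq.
  by move=> i; rewrite wn => ni; rewrite nth_nseq ni; apply: al; rewrite mem_iota.
by rewrite mem_iota add0n => /andP[_ ni]; rewrite nth_nseq ni.
Qed.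

(** Applying [u] to the lower faces one after another turns the constant cube [x] into one with
    [u x] at every vertex but the last, since [u] is idempotent. Uniqueness of the last vertex
    forces [x = u x]. *)
Lemma facegp_idempotent u : facegp u -> u \o u = u -> u = id.
Proof.
move=> Gu uu; apply/funext => x.
have uux y : u (u y) = u y by rewrite -[LHS]/((u \o u) y) uu.
have : Q (fun w => if all (nth false w) (iota 0 n) then x else u x).
  have : (n <= n)%N by []. move: {-2}n => m; elim: m => [_|m IH mn].
    exact: Qcst.
  have := Gu m false mn _ (IH (ltnW mn)); apply: Q_ext => w _.
  rewrite /onface -[in RHS]addn1 iotaD all_cat /= andbT add0n.
  by case: (nth false w m) => /=; rewrite ?andbT ?andbF//; case: ifP => // _.
move=> /(@Quniq _ (u x)); rewrite all_bits ?size_nseq// eqxx => E; apply: esym; apply: E => w wn wT.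
by rewrite (all_bits wn); case: eqP.
Qed.

(** For [t] in [S] the closed semigroup [S \o t] contains an idempotent, which is the identity. So
    every element has a left inverse in [S], and [S] is a group. *)
Lemma facegp_inv (S : set (X -> X)) u : S `<=` facegp -> uclosed S -> comp_closed S ->
  S u -> exists v, [/\ S v, cancel u v & cancel v u].
Proof.
move=> SG cS mS Su.
have li t : S t -> exists2 s, S s & s \o t = id.
  move=> St.
  have [|||s] := @ellis_idempotent X hX cX [set s \o t | s in S].
  - by exists (t \o t), t.
  - by apply: uclosed_comp_image => //; exists t.
  - move=> _ _ [a Sa <-] [b Sb <-]; exists (a \o t \o b) => //.
    by apply: (mS) => //; exact: mS.
  - by move=> [a Sa <-] idem; exists a => //; apply: facegp_idempotent => //; apply: SG; exact: mS.
have [s Ss st] := li u Su; have [t St ts] := li s Ss.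
have tu : t = u by rewrite -[RHS]/(id \o u) -ts -compA st.
exists s; split=> // x; first by rewrite -[LHS]/((s \o u) x) st.
by rewrite -[LHS]/((u \o s) x) -tu ts.
Qed.

Definition corner j (u : X -> X) := forall y, Q y ->
  Q (fun w => if all (nth false w) (iota 0 j) then u (y w) else y w).

Lemma corner_uclosed j : uclosed (corner j).
Proof.
move=> I F v u FU Fv vu y Qy.
have FP : ProperFilter F by exact: ultra_proper.
apply: (@Q_limit I F (fun i w => if all (nth false w) (iota 0 j) then v i (y w) else y w)).
  by apply: filterS Fv => i; exact.
by move=> w; case: ifP => _; [exact: vu|exact: cvg_cst].
Qed.

Lemma corner_comp j : comp_closed (corner j).
Proof.
by move=> u v Gu Gv y Qy; have := Gu _ (Gv _ Qy); apply: Q_ext => w _; case: (all _ _).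
Qed.

(** [facegp] and [corner j] cut out a closed semigroup, hence a group. *)
Lemma corner_inv j u u' : facegp u -> corner j u -> cancel u u' -> cancel u' u -> corner j u'.
Proof.
move=> Gu Cu uK uK'.
have [||||v [[Gv Cv] uv vu]] := @facegp_inv (facegp `&` corner j) u.
- by move=> x [].
- by apply: uclosedI; [exact: facegp_uclosed|exact: corner_uclosed].
- by move=> a b [? ?] [? ?]; split; [exact: facegp_comp|exact: corner_comp].
- by split.
suff -> : u' = v by [].
by apply/funext => x; rewrite -[in LHS](vu x) uK.
Qed.

(** [u] acts where the first [j] coordinates are [true], and [v] where coordinate [j] is. At a
    vertex in only one of these faces the factors cancel, and the commutator survives on the
    intersection. *)
Lemma corner_commutator j u u' v v' : (j < n)%N -> facegp u -> corner j u -> facegp v ->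
  facegp v' ->
  cancel u u' -> cancel u' u -> cancel v v' -> cancel v' v ->
  corner j.+1 (v \o u \o v' \o u').
Proof.
move=> jn Gu Cu Gv Gv' uK uK' vK vK' y Qy.
have Cu' := corner_inv Gu Cu uK uK'.
have := Gv j true jn _ (Cu _ (Gv' j true jn _ (Cu' _ Qy))); apply: Q_ext => w _.
rewrite /onface -[in RHS]addn1 iotaD all_cat /= andbT add0n.
case: (all _ _); case: (nth false w j) => //=; by rewrite ?uK' ?vK'.
Qed.

Lemma corner_top u : corner n u -> u = id.
Proof.
move=> Cu; apply/funext => x; have /(@Quniq _ x) := Cu _ (Qcst x).
rewrite all_bits ?size_nseq// eqxx => E; apply: E => w wn wT.
by rewrite (all_bits wn); case: eqP.
Qed.

Variables (nn : nat -> nat) (x0 : X).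

(* The positive integers are split in k residue classes: class r at time t is
   the index t k + r + 1.  A state is the set of classes that are switched on. *)
Definition idx (t : nat) (r : 'I_k) : nat := (t * k + r).+1.
Definition psum (r : 'I_k) (j : nat) : int := (\sum_(t < j) nn (idx t r))%:Z.
Definition swt (A : {set 'I_k}) (t : nat) : int := (\sum_(r in A) nn (idx t r))%:Z.
Definition wt (L : nat) (s : nat -> {set 'I_k}) : int := \sum_(t < L) swt (s t) t.

(** A class shared by consecutive states bridges blocks [t] and [t.+1] with a gap of at most [k].
    The empty state may follow any state, but no other state may follow it. *)
Definition legal_at (s : nat -> {set 'I_k}) t := s t.+1 != finset.set0 -> s t :&: s t.+1 != finset.set0.

(* Limits of T^(n_beta) x0 where beta contains exactly the classes of S up to an
   arbitrarily late time, and then goes on without long gaps. *)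
Definition reach (S : {set 'I_k}) (y : X) := forall U J, nbhs y U ->
  exists s L, [/\ (forall t, legal_at s t), (forall t, (L <= t)%N -> s t = finset.set0),
    (forall t, (t <= J)%N -> s t = S) & U (A (wt L s) x0)].

Lemma wt_stable L L' s : (L <= L')%N -> (forall t, (L <= t)%N -> s t = finset.set0) ->
  wt L' s = wt L s.
Proof.
move=> LL' sL; rewrite /wt -(subnKC LL') big_split_ord /= [X in _ + X]big1 ?addr0//.
by move=> i _; rewrite sL ?leq_addr// /swt big_set0.
Qed.

Lemma reach0 : reach finset.set0 x0.
Proof.
move=> U J Ux; exists (fun=> finset.set0), 0%N; split=> //.
  by move=> t; rewrite /legal_at eqxx.
by rewrite /wt big_ord0 A0; exact: nbhs_singleton.
Qed.

Lemma wt_switch L j (s : nat -> {set 'I_k}) (S : {set 'I_k}) : (j <= L)%N ->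
  wt L (fun t => if (t < j)%N then S else s t) =
  \sum_(t < j) (swt S t - swt (s t) t) + wt L s.
Proof.
move=> jL; rewrite /wt -(subnKC jL) !big_split_ord /= addrA -big_split /=; congr (_ + _).
  by apply: eq_bigr => i _; rewrite ltn_ord subrK.
by apply: eq_bigr => i _; rewrite ltnNge leq_addr.
Qed.

(* Switching from S to S' at a late time j: the limits of A (v j) map
   [reach S'] into [reach S] when v j is the weight difference up to j. *)
Lemma reach_switch (F : set_system nat) (v : nat -> int) u (S S' : {set 'I_k}) :
  ProperFilter F -> \oo `<=` F ->
  (forall x, (fun j => A (v j) x) @ F --> u x) ->
  (S' != finset.set0 -> S :&: S' != finset.set0) ->
  (forall j, v j = \sum_(t < j) (swt S t - swt S' t)) ->
  forall y, reach S' y -> reach S (u y).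
Proof.
move=> FP Foo vu SS' vE y Ry U J Uy.
have Uo : nbhs (u y) (U^°)%classic by exact: nbhs_interior.
have Fv : \forall j \near F, (U^°)%classic (A (v j) y) by exact: vu y _ Uo.
have FJ : \forall j \near F, (J < j)%N by apply: Foo; exact: nbhs_infty_gt.
have [j [Uj Jj]] := filter_ex (filterI Fv FJ).
have Uj' : nbhs y (A (v j) @^-1` U) by exact: (Ac (z := v j) Uj).
have [s [L [ls sL sJ Us]]] := Ry _ j Uj'.
pose L' := maxn L j.
exists (fun t => if (t < j)%N then S else s t), L'; split.
- move=> t; rewrite /legal_at; case: (ltngtP t.+1 j) => [tj|jt|tj].
  + by rewrite finset.setIid.
  + exact: ls.
  + by rewrite sJ ?tj//; exact: SS'.
- move=> t; rewrite geq_max => /andP[Lt jt]; rewrite ltnNge jt; exact: sL.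
- by move=> t tJ; rewrite (leq_ltn_trans tJ Jj).
- rewrite wt_switch ?leq_maxr// (wt_stable (leq_maxl _ _) sL).
  have -> : \sum_(t < j) (swt S t - swt (s t) t) = v j.
    by rewrite vE; apply: eq_bigr => t _; rewrite sJ// ltnW.
  by rewrite AD; exact: Us.
Qed.

Lemma idx_inj t t' (r r' : 'I_k) : idx t r = idx t' r' -> t = t' /\ r = r'.
Proof.
case=> E; have rk := ltn_ord r; have rk' := ltn_ord r'.
have tt : t = t'.
  by move/(congr1 (divn^~ k)): E; rewrite !divnMDl// !divn_small// !addn0.
by split=> //; apply: val_inj; move: E; rewrite tt => /addnI.
Qed.

(** Let [idx t r] be an element. A class [q] shared with the next state gives a successor: in the
    same block if [r < q], otherwise in the next one. If the next state is empty, so are all later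
    ones, and the element has a successor in its block or is the maximum. *)
Lemma in_S_of_states (L j : nat) (s : nat -> {set 'I_k}) :
  (j < L)%N -> s j != finset.set0 -> (forall t, (j <= t)%N -> legal_at s t) ->
  (forall t, (t < j)%N -> s t = finset.set0) -> (forall t, (L <= t)%N -> s t = finset.set0) ->
  in_S k [seq idx t r | t <- iota 0 L, r <- enum (s t)].
Proof.
move=> jL sj ls s0 sL; set al := [seq _ | _ <- _, _ <- _].
have alP i : reflect (exists t r, r \in s t /\ i = idx t r) (i \in al).
  apply: (iffP allpairsPdep) => [[t [r [_ + ->]]]|[t [r [rs ->]]]].
    by rewrite mem_enum => rs; exists t, r.
  exists t, r; rewrite mem_enum mem_iota add0n leq0n /=; split=> //.
  by rewrite ltnNge; apply: contraL rs => Lt; rewrite sL// inE.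
split.
  split.
  - apply: allpairs_uniq_dep; first exact: iota_uniq.
      by move=> t _; exact: enum_uniq.
    by move=> [t r] [t' r'] _ _ /= /idx_inj[-> ->].
  - have /set0Pn[r rs] := sj; have : idx j r \in al by apply/alP; exists j, r.
    by apply: contraTneq => ->.
  - by apply/allP => i /alP[t [r [_ ->]]].
move=> i /alP[t [r [rs ->{i}]]].
have jt : (j <= t)%N by rewrite leqNgt; apply: contraL rs => /s0 ->; rewrite inE.
have rk := ltn_ord r.
have [s1|s1] := eqVneq (s t.+1) finset.set0; last first.
  have /set0Pn[q] := ls t jt s1; rewrite inE => /andP[qs qs1]; have qk := ltn_ord q.
  right; have [rq|qr] := ltnP r q.
    exists (idx t q); first by apply/alP; exists t, q.
    rewrite /idx ltnS ltn_add2l rq /= addSn ltnS -addnA leq_add2l.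
    by rewrite (leq_trans (ltnW qk))// leq_addl.
  exists (idx t.+1 q); first by apply/alP; exists t.+1, q.
  rewrite /idx mulSn ltnS addSn ltnS; apply/andP; split.
    by rewrite (addnC k) -addnA ltn_add2l ltn_addr.
  by rewrite (addnC k) -!addnA leq_add2l addnC leq_add2r.
have sv q : s (t.+1 + q)%N = finset.set0.
  elim: q => [|q IH]; first by rewrite addn0.
  apply/eqP; apply: contraT; rewrite addnS => /(ls _ (leq_trans jt (leqW (leq_addr _ _)))).
  by rewrite IH finset.set0I eqxx.
have [[q qs rq]|nq] := pselect (exists2 q : 'I_k, q \in s t & (r < q)%N).
  right; have qk := ltn_ord q; exists (idx t q); first by apply/alP; exists t, q.
  rewrite /idx ltnS ltn_add2l rq /= addSn ltnS -addnA leq_add2l.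
  by rewrite (leq_trans (ltnW qk))// leq_addl.
left; apply/eqP; rewrite eqn_leq; apply/andP; split.
  by apply: (@leq_bigmax_seq _ _ _ id) => //; apply/alP; exists t, r.
apply/bigmax_leqP_seq => _ /alP[t' [r' [rs' ->]]] _.
have r'k := ltn_ord r'.
have t't : (t' <= t)%N.
  by rewrite leqNgt; apply: contraL rs' => /subnKC <-; rewrite sv inE.
move: t't; rewrite leq_eqVlt => /orP[/eqP E|t't].
  rewrite /idx E ltnS leq_add2l leqNgt; apply/negP => rr'; apply: nq; exists r' => //.
  by rewrite -E.
rewrite /idx ltnS (@leq_trans (t'.+1 * k))//; last by rewrite (leq_trans _ (leq_addr _ _))// leq_mul2r t't orbT.
by rewrite mulSn addnC leq_add2r ltnW.
Qed.

(** Passing from the empty state to [[set r]] is not legal, so it is allowed once, at the start: the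
    path is erased before a late time [j], and legality is only required from [j] on. *)
Lemma reach_start (F : set_system nat) (v : nat -> int) u (r : 'I_k) y U :
  ProperFilter F -> \oo `<=` F ->
  (forall x, (fun j => A (v j) x) @ F --> u x) ->
  (forall j, v j = \sum_(t < j) (swt finset.set0 t - swt [set r]%SET t)) ->
  reach [set r]%SET y -> u y = x0 -> nbhs x0 U ->
  exists alpha, in_S k alpha /\ U (A (n_sum nn alpha)%:Z x0).
Proof.
move=> FP Foo vu vE Ry uy Ux; rewrite -uy in Ux.
have Fv : \forall j \near F, (U^°)%classic (A (v j) y).
  by apply: (vu y); exact: nbhs_interior.
have [j Uj] := filter_ex Fv.
have Uj' : nbhs y (A (v j) @^-1` U) by exact: (Ac (z := v j) Uj).
have [s [L [ls sL sJ Us]]] := Ry _ j Uj'.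
pose s' t := if (t < j)%N then finset.set0 else s t.
pose L' := maxn L j.+1.
exists [seq idx t q | t <- iota 0 L', q <- enum (s' t)]; split.
  apply: (@in_S_of_states L' j s').
  - exact: leq_maxr.
  - by rewrite /s' ltnn sJ//; apply/set0Pn; exists r; rewrite inE.
  - by move=> t jt; rewrite /legal_at /s' ltnNge (leqW jt) ltnNge jt; exact: ls.
  - by move=> t tj; rewrite /s' tj.
  - move=> t; rewrite geq_max => /andP[Lt jt]; rewrite /s' ltnNge (ltnW jt); exact: sL.
suff -> : (n_sum nn [seq idx t q | t <- iota 0 L', q <- enum (s' t)])%:Z = v j + wt L s.
  by rewrite AD; exact: Us.
have -> : v j + wt L s = wt L' s'.
  have jL' : (j <= L')%N by exact: leq_trans (leqnSn j) (leq_maxr _ _).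
  rewrite (wt_switch s finset.set0 jL') (wt_stable (leq_maxl _ _) sL) vE.
  by congr (_ + _); apply: eq_bigr => t _; rewrite [s t]sJ// ltnW.
rewrite /n_sum big_allpairs_dep /wt /swt -(big_mkord xpredT (fun t => (\sum_(q in s' t) nn (idx t q))%:Z)).
rewrite /index_iota subn0 -[RHS](big_morph Posz PoszD (erefl 0%:Z)).
by congr Posz; apply: eq_bigr => t _; rewrite big_enum.
Qed.

(** Its elements play the part of paths from state [S] to state [S']: they prepend such a segment to
    the paths counted by [reach S']. *)
Definition trans (S S' : {set 'I_k}) : set (X -> X) :=
  facegp `&` [set u | forall y, reach S' y -> reach S (u y)].

Lemma reach_closed (I : Type) (F : set_system I) (f : I -> X) S y : ProperFilter F ->
  (\forall i \near F, reach S (f i)) -> f @ F --> y -> reach S y.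
Proof.
move=> FP Ff fy U J Uy; have Fi : \forall i \near F, (U^°)%classic (f i).
  by apply: fy; exact: nbhs_interior.
by have [i [Ri Ui]] := filter_ex (filterI Ff Fi); exact: Ri.
Qed.

Lemma trans_uclosed S S' : uclosed (trans S S').
Proof.
apply: uclosedI; first exact: facegp_uclosed.
move=> I F v u FU Fv vu y Ry; have FP : ProperFilter F by exact: ultra_proper.
by apply: reach_closed (vu y); apply: filterS Fv => i; exact.
Qed.

Lemma trans_comp S1 S2 S3 u v : trans S1 S2 u -> trans S2 S3 v -> trans S1 S3 (u \o v).
Proof.
move=> [Gu Ru] [Gv Rv]; split; first exact: facegp_comp.
by move=> y Ry; apply: Ru; exact: Rv.
Qed.

(** As soon as some [v] leads back, [v \o u] lies in the closed semigroup [trans S' S'], which is a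
    group; with [w] its inverse there, [u' = w \o v]. *)
Lemma trans_inv S S' u u' v : trans S S' u -> trans S' S v ->
  cancel u u' -> cancel u' u -> trans S' S u'.
Proof.
move=> Tu Tv uK uK'; have Tvu := trans_comp Tv Tu.
have [||||w [Tw wK wK']] := @facegp_inv (trans S' S') (v \o u).
- by move=> x [].
- exact: trans_uclosed.
- by move=> a b; exact: trans_comp.
- exact: Tvu.
suff -> : u' = w \o v by exact: trans_comp Tw Tv.
by apply/funext => x; rewrite -[in RHS](uK' x) /=; exact/esym/wK.
Qed.

Lemma trans_invs S u u' : trans S S u -> cancel u u' -> cancel u' u -> trans S S u'.
Proof. by move=> Tu; exact: (trans_inv Tu Tu). Qed.

Theorem gap_recurrence U : nbhs x0 U ->
  exists alpha, in_S k alpha /\ U (A (n_sum nn alpha)%:Z x0).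
Proof.
move=> Ux0.
have [F [FU Foo]] := ultraFilterLemma eventually_filter.
have FP : ProperFilter F by exact: ultra_proper.
have [L LP] := @ultra_limit X cX nat F FU.
pose a r x := L (fun j => A (psum r j) x).
pose b r x := L (fun j => A (- psum r j) x).
have aP r x : (fun j => A (psum r j) x) @ F --> a r x by exact: LP.
have bP r x : (fun j => A (- psum r j) x) @ F --> b r x by exact: LP.
have Ga r : facegp (a r).
  by apply: (@facegp_uclosed nat F _ _ FU _ (aP r)); apply: filterE => j; exact: facegp_A.
have Gb r : facegp (b r).
  by apply: (@facegp_uclosed nat F _ _ FU _ (bP r)); apply: filterE => j; exact: facegp_A.
have swt1 (S : {set 'I_k}) (r : 'I_k) t : r \notin S ->
    swt (r |: S)%SET t = swt S t + (nn (idx t r))%:Z.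
  by move=> rS; rewrite /swt big_setU1//= PoszD addrC.
have Ta (S : {set 'I_k}) (r : 'I_k) : r \notin S -> trans (r |: S)%SET S (a r).
  move=> rS; split=> //; apply: (@reach_switch F (psum r)) => //.
    by move=> /set0Pn[q qS]; apply/set0Pn; exists q; rewrite !inE qS orbT.
  move=> j; rewrite /psum (big_morph Posz PoszD (erefl 0%:Z)).
  by apply: eq_bigr => t _; rewrite swt1// addrAC subrr add0r.
have Tb (S : {set 'I_k}) (r : 'I_k) : r \notin S -> S != finset.set0 -> trans S (r |: S)%SET (b r).
  move=> rS S0; split=> //; apply: (@reach_switch F (fun j => - psum r j)) => //.
    move=> _; have /set0Pn[q qS] := S0; apply/set0Pn; exists q.
    by rewrite !inE qS orbT.
  move=> j; rewrite /psum (big_morph Posz PoszD (erefl 0%:Z)) -sumrN.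
  by apply: eq_bigr => t _; rewrite swt1// opprD addrA subrr add0r.
have Ginv u : facegp u -> exists u', [/\ facegp u', cancel u u' & cancel u' u].
  by apply: (@facegp_inv facegp) => //; [exact: facegp_uclosed|exact: facegp_comp].
have [a' a'P] := choice (fun r => Ginv _ (Ga r)).
have [b' b'P] := choice (fun r => Ginv _ (Gb r)).
(* Limits of mutually inverse maps need not be inverse to each other; [z0] measures the failure for
   class 0. *)
pose z0 := b' ord0 \o a' ord0.
have Gz0 : facegp z0.
  by apply: facegp_comp; [have [] := b'P ord0|have [] := a'P ord0].
(* joint limit of A (M j) on one face and A (- M j) on another one *)
have Cz0 : corner 2 z0.
  move=> y Qy.
  have Q1 : Q (fun w => if nth false w 0 then
      (if nth false w 1 then y w else a ord0 (y w)) else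
      (if nth false w 1 then b ord0 (y w) else y w)).
    apply: (@Q_limit nat F (fun j => onface 0 true (A (psum ord0 j))
      (onface 1 true (A (- psum ord0 j)) y))).
      by apply: filterE => j; apply: facegp_A => //; exact: facegp_A.
    move=> w; rewrite /onface; case: (nth false w 0); case: (nth false w 1) => //=.
    - under eq_fun do rewrite -AD subrr A0; exact: cvg_cst.
    - exact: cvg_cst.
  have [Gb' bK b'K] := b'P ord0; have [Ga' aK a'K] := a'P ord0.
  have := Gb' 1%N true (isT : (1 < n)%N) _ (Ga' 0%N true (isT : (0 < n)%N) _ Q1).
  apply: Q_ext => w _; rewrite /onface /= andbT.
  by case: (nth false w 0); case: (nth false w 1) => //=; rewrite ?aK ?bK.
(* Another class of [B] stays on, so class 0 may be switched off and on again; [trans_inv] makes the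
   inverses of both switches legal. *)
have Vz0 (B : {set 'I_k}) : ord0 \in B -> (exists2 r : 'I_k, r \in B & (0 < r)%N) ->
    trans B B z0.
  move=> B0 [r rB r0]; set C := (B :\ ord0)%SET.
  have CE : (ord0 |: C)%SET = B by rewrite finset.setD1K.
  have nC : ord0 \notin C by rewrite !inE eqxx.
  have C0 : C != finset.set0.
    by apply/set0Pn; exists r; rewrite !inE rB andbT -val_eqE /= -lt0n.
  have ta := Ta C ord0 nC; have tb := Tb C ord0 nC C0; rewrite CE in ta tb.
  have [_ aK a'K] := a'P ord0; have [_ bK b'K] := b'P ord0.
  exact: trans_comp (trans_inv tb ta bK b'K) (trans_inv ta tb aK a'K).
(* Here [u] is the iterated commutator [z_j]. The third clause concerns states with 0, a class above
   [j], and none of the classes used so far; the fourth carries legality at the state {0} back from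
   [u] to [z0]. *)
have key j : (j < k)%N -> exists u, [/\ facegp u, corner j.+2 u,
    (forall B : {set 'I_k}, ord0 \in B -> (forall i : 'I_k, (0 < i <= j)%N -> i \notin B) ->
       (exists2 r : 'I_k, r \in B & (j < r)%N) -> trans B B u) &
    (trans [set ord0]%SET [set ord0]%SET u -> trans [set ord0]%SET [set ord0]%SET z0)].
  elim: j => [_|j IH jk].
    by exists z0; split=> // B B0 _; exact: Vz0.
  have [u [Gu Cu Vu Ru]] := IH (ltnW jk).
  have [u' [Gu' uK uK']] := Ginv _ Gu.
  pose r := Ordinal jk; have [Gbr bK bK'] := b'P r.
  exists (b r \o u \o b' r \o u'); split.
  - by do ![apply: facegp_comp => //].
  - by apply: corner_commutator => //; rewrite ltnS; exact: ltnW.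
  - move=> B B0 Bj [q qB jq].
    have Bj' (i : 'I_k) : (0 < i <= j)%N -> i \notin B.
      by move=> /andP[i0 ij]; apply: Bj; rewrite i0 leqW.
    have rB : r \notin B by apply: Bj => /=.
    have B1 : B != finset.set0 by apply/set0Pn; exists ord0.
    have TuB : trans B B u by apply: Vu => //; exists q => //; exact: ltnW.
    have TurB : trans (r |: B)%SET (r |: B)%SET u.
      apply: Vu; first by rewrite !inE B0 orbT.
        move=> i ij; rewrite !inE negb_or Bj'// andbT -val_eqE /=.
        by apply: contraTneq ij => ->; rewrite ltnn andbF.
      by exists r => //; rewrite !inE eqxx.
    have tb := Tb B r rB B1; have tb' := trans_inv tb (Ta B r rB) bK bK'.
    apply: trans_comp (trans_invs TuB uK uK').
    by apply: trans_comp tb'; apply: trans_comp tb _.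
  - move=> Tw; apply: Ru; set B := [set ord0]%SET.
    have r0 : r != ord0 by [].
    have rB : r \notin B by rewrite !inE.
    have B1 : B != finset.set0 by apply/set0Pn; exists ord0; rewrite !inE.
    have TurB : trans (r |: B)%SET (r |: B)%SET u.
      apply: Vu; first by rewrite !inE eqxx orbT.
        move=> i /andP[i0 ij]; rewrite !inE negb_or -!val_eqE /= -lt0n i0 andbT.
        by rewrite neq_ltn ltnS ij.
      by exists r => //; rewrite !inE eqxx.
    have tb := Tb B r rB B1; have tb' := trans_inv tb (Ta B r rB) bK bK'.
    have T1 : trans B B (b r \o u \o b' r).
      by apply: trans_comp tb'; apply: trans_comp tb _.
    (* [w'] inverts the commutator. The factor [b r \o u \o b' r] is legal at {0}, as it runs [u] in
       the state {0, r}; so legality of the commutator implies that of [u]. *)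
    pose w' := u \o b r \o u' \o b' r.
    have wK : cancel (b r \o u \o b' r \o u') w' by move=> x; rewrite /w' /= bK uK bK' uK'.
    have wK' : cancel w' (b r \o u \o b' r \o u') by move=> x; rewrite /w' /= uK bK uK' bK'.
    suff -> : u = w' \o (b r \o u \o b' r) by exact: trans_comp (trans_invs Tw wK wK') T1.
    by apply/funext => x; rewrite /w' /= bK uK bK'.
(* For [j = k'] the codimension [k'.+2] is the full dimension [n], so [u] is the identity. *)
have [u [Gu Cu _ Ru]] := key k' (ltnSn k').
have uid := corner_top Cu.
have Tz0 : trans [set ord0]%SET [set ord0]%SET z0.
  apply: Ru; rewrite uid; split=> // i c ni y Qy.
  by apply: Q_ext Qy => w _; rewrite /onface; case: eqP.
have [_ aK a'K] := a'P ord0; have [_ bK b'K] := b'P ord0.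
have R1 : reach [set ord0]%SET (a ord0 x0).
  have n0 : (ord0 : 'I_k) \notin finset.set0 by rewrite finset.in_set0.
  have [_ T] := Ta finset.set0 ord0 n0.
  by have := T _ reach0; rewrite finset.setU0.
have R2 : reach [set ord0]%SET (b' ord0 x0).
  by have [_ /(_ _ R1)] := Tz0; rewrite /z0 /= aK.
apply: (@reach_start F (fun j => - psum ord0 j) (b ord0) ord0 (b' ord0 x0)) => //.
move=> j; rewrite /psum (big_morph Posz PoszD (erefl 0%:Z)) -sumrN.
by apply: eq_bigr => t _; rewrite /swt big_set0 big_set1 sub0r.
Qed.

End Recurrence.

End Dynamics.

Section LieGroups.
Import Order.TTheory GRing.Theory Num.Theory.
Import numFieldNormedType.Exports.
Local Open Scope ring_scope.

(** * Lie groups have no small subgroups *)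

Section StrictDifferentiability.
Variables (R : realType) (p m : nat).
Implicit Types (f : 'rV[R]_p -> 'rV[R]_m) (x v z h : 'rV[R]_p).

Lemma mx_norm_le (n : nat) (M : 'rV[R]_n) (e : R) : 0 <= e ->
  (forall j, `|M 0 j| <= e) -> `|M| <= e.
Proof.
move=> e0 Me; rewrite /Num.norm /= mx_normrE; apply: bigmax_le => // -[i j] _ /=.
by rewrite ord1; exact: Me.
Qed.

Lemma mx_norm_coord (n : nat) (M : 'rV[R]_n) j : `|M 0 j| <= `|M|.
Proof.
rewrite [X in _ <= X]/Num.norm /= mx_normrE.
exact: (@le_bigmax _ _ _ 0 (fun ij : 'I_1 * 'I_n => `|M ij.1 ij.2|) (0, j)).
Qed.

Lemma is_derive_coord f x v (t : R) j : derivable f (x + t *: v) v ->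
  is_derive t (1 : R) (fun s : R => f (x + s *: v) 0 j) ('D_v f (x + t *: v) 0 j).
Proof.
move=> df.
have cv : (fun h : R => h^-1 *: (f (x + (h *: 1 + t) *: v) 0 j - f (x + t *: v) 0 j)) @ 0^' -->
    'D_v f (x + t *: v) 0 j.
  have -> : (fun h : R => h^-1 *: (f (x + (h *: 1 + t) *: v) 0 j - f (x + t *: v) 0 j)) =
     (fun M : 'rV[R]_m => M 0 j) \o
     (fun h : R => h^-1 *: ((f \o shift (x + t *: v)) (h *: v) - f (x + t *: v))).
    apply/funext => h /=; rewrite !mxE; congr (_ * (f _ _ _ - _)).
    by rewrite /shift /= scalerDl -[h *: 1]/(h * 1) mulr1 addrCA.
  by apply: cvg_comp; [exact: df|exact: coord_continuous].
split; first by apply/cvg_ex; exists ('D_v f (x + t *: v) 0 j).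
exact: cvg_lim cv.
Qed.

(** The one-variable mean value theorem is applied to each coordinate. The intermediate points
    differ, which is harmless for the sup norm. *)
Lemma mean_value_coord f x v (a e : R) (L : 'rV[R]_m) : 0 <= e ->
  (forall t, `|t| <= `|a| -> derivable f (x + t *: v) v /\ `|'D_v f (x + t *: v) - L| <= e) ->
  `|f (x + a *: v) - f x - a *: L| <= e * `|a|.
Proof.
move=> e0 df; apply: mx_norm_le; first exact: mulr_ge0.
move=> j; rewrite !mxE; set F := fun s : R => f (x + s *: v) 0 j.
set dF := fun s : R => 'D_v f (x + s *: v) 0 j.
have F0 : F 0 = f x 0 j by rewrite /F scale0r addr0.
have dFe t : `|t| <= `|a| -> `|dF t - L 0 j| <= e.
  move=> /df[_]; apply: le_trans.
  by have := mx_norm_coord ('D_v f (x + t *: v) - L) j; rewrite !mxE.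
have iF t : `|t| <= `|a| -> is_derive t (1 : R) F (dF t).
  by move=> /df[dft _]; exact: is_derive_coord.
have cF t : `|t| <= `|a| -> {for t, continuous F}.
  by move=> /iF[+ _]; move=> /derivable1_diffP/differentiable_continuous.
suff [c ca ->] : exists2 c, `|c| <= `|a| & f (x + a *: v) 0 j - f x 0 j = dF c * a.
  by rewrite [a * _]mulrC -mulrBl normrM ler_wpM2r// dFe.
rewrite -F0 -[f (x + a *: v) 0 j]/(F a).
have [a0|a0] := leP 0 a.
  have ina t : 0 <= t <= a -> `|t| <= `|a|.
    by move=> /andP[t0 ta]; rewrite !ger0_norm// (le_trans t0).
  have [t||c] := @MVT_segment R F dF 0 a a0.
  - by rewrite in_itv /= => /andP[/ltW t0 /ltW ta]; apply: iF; apply: ina; rewrite t0.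
  - apply/continuous_in_subspaceT => t; rewrite inE /= in_itv /= => ta.
    by apply: cF; exact: ina.
  - by rewrite in_itv /= subr0 => ca ->; exists c => //; exact: ina.
have ina t : a <= t <= 0 -> `|t| <= `|a|.
  by move=> /andP[at0 t0]; rewrite !ler0_norm ?lerN2// ltW.
have [t||c] := @MVT_segment R F dF a 0 (ltW a0).
- by rewrite in_itv /= => /andP[/ltW t0 /ltW ta]; apply: iF; apply: ina; rewrite t0.
- apply/continuous_in_subspaceT => t; rewrite inE /= in_itv /= => ta.
  by apply: cF; exact: ina.
- rewrite in_itv /= sub0r mulrN => ca E; exists c; first exact: ina.
  by rewrite -[RHS]opprK -E opprB.
Qed.

Definition trunc (h : 'rV[R]_p) (k : nat) : 'rV[R]_p := \row_i (if (i < k)%N then h 0 i else 0).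

(** [z] is joined to [z + h] one coordinate at a time through [trunc h k]. Every point met is within
    2|h| of [z], and each of the [p] moves costs an error of at most e|h|. *)
Lemma increment_bound f z h z0 (r e : R) (L : 'I_p -> 'rV[R]_m) : 0 <= e ->
  (forall y k, `|y - z0| < r -> derivable f y (delta_mx 0 k) /\
     `|'D_(delta_mx 0 k) f y - L k| <= e) ->
  `|z - z0| + 2 * `|h| < r ->
  `|f (z + h) - f z - \sum_k h 0 k *: L k| <= p%:R * e * `|h|.
Proof.
move=> e0 df zr.
have truncS (k : 'I_p) : trunc h k.+1 = trunc h k + h 0 k *: delta_mx 0 k.
  apply/rowP => i; rewrite !mxE /= ; have [->|ik] := eqVneq i k.
    by rewrite ltnn ltnSn mulr1 add0r.
  have /negbTE ik' : (i : nat) != k by [].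
  by rewrite mulr0 addr0 ltnS leq_eqVlt ik'.
have tle k : `|trunc h k| <= `|h|.
  by apply: mx_norm_le => // j; rewrite !mxE; case: ifP => _; rewrite ?normr0// mx_norm_coord.
have -> : f (z + h) - f z = \sum_(k < p) (f (z + trunc h k.+1) - f (z + trunc h k)).
  rewrite -(big_mkord xpredT (fun k => f (z + trunc h k.+1) - f (z + trunc h k))).
  rewrite telescope_sumr//; congr (f (z + _) - f _).
    by apply/rowP => i; rewrite !mxE ltn_ord.
  by rewrite (_ : trunc h 0 = 0) ?addr0//; apply/rowP => i; rewrite !mxE.
rewrite -sumrB; apply: le_trans (ler_norm_sum _ _ _) _.
rewrite -mulrA -[p in p%:R]card_ord mulr_natl -sumr_const; apply: ler_sum => k _.
rewrite truncS addrA; apply: (@le_trans _ _ (e * `|h 0 k|)); last first.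
  by apply: ler_wpM2l => //; exact: mx_norm_coord.
apply: mean_value_coord => // t th.
apply: df; apply: le_lt_trans zr.
have -> : z + trunc h k + t *: delta_mx 0 k - z0 = (z - z0) + (trunc h k + t *: delta_mx 0 k).
  by rewrite -!addrA; congr (_ + _); rewrite addrA addrC.
apply: le_trans (ler_normD _ _) _; rewrite lerD2l mulr_natl mulr2n.
apply: le_trans (ler_normD _ _) _; apply: lerD => //.
rewrite normrZ; apply: le_trans (_ : `|h 0 k| * 1 <= _); last by rewrite mulr1 mx_norm_coord.
apply: ler_pM => //; apply: mx_norm_le => // j; rewrite !mxE eqxx /=.
by case: (_ == _); rewrite ?normr0 ?normr1.
Qed.

End StrictDifferentiability.

Lemma row_mx_norm (R : realType) (n1 n2 : nat) (u : 'rV[R]_n1) (v : 'rV[R]_n2) (M : R) :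
  `|u| <= M -> `|v| <= M -> `|row_mx u v| <= M.
Proof.
move=> uM vM; apply: mx_norm_le; first exact: le_trans uM.
move=> j; rewrite mxE; case: splitP => k _.
  exact: le_trans (mx_norm_coord _ _) uM.
exact: le_trans (mx_norm_coord _ _) vM.
Qed.

Lemma lsubmx_continuous (R : realType) (n1 n2 : nat) :
  continuous (fun z : 'rV[R]_(n1 + n2) => lsubmx z).
Proof.
move=> z; apply/(@cvgrPdist_lt _ _ _ (nbhs z) (nbhs_filter z)) => eps e0; apply/(@nbhs_normP R 'rV[R]_(n1 + n2)); exists eps => //= y.
apply: le_lt_trans; apply: mx_norm_le => // j; rewrite !mxE.
by have := mx_norm_coord (z - y) (lshift n2 j); rewrite !mxE.
Qed.

Lemma rsubmx_continuous (R : realType) (n1 n2 : nat) :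
  continuous (fun z : 'rV[R]_(n1 + n2) => rsubmx z).
Proof.
move=> z; apply/(@cvgrPdist_lt _ _ _ (nbhs z) (nbhs_filter z)) => eps e0; apply/(@nbhs_normP R 'rV[R]_(n1 + n2)); exists eps => //= y.
apply: le_lt_trans; apply: mx_norm_le => // j; rewrite !mxE.
by have := mx_norm_coord (z - y) (rshift n1 j); rewrite !mxE.
Qed.

(** * Charts of a Lie group at the identity *)

Section LieLocal.
Variables (T : topologicalType) (mul : T -> T -> T) (inv : T -> T) (e : T).
Hypothesis lieT : lie_group mul inv e.

(* A chart at e in which the product is strictly differentiable at (e, e): up to
   o(h), squaring is multiplication by 2. *)
Lemma lie_chart_square : exists n (c : chart T n) (r : RR), [/\ is_chart c, ch_dom c e, 0 < r,
  (forall y, `|y - ch_fwd c e| <= r -> chart_img c y) &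
  (forall x, ch_dom c x -> `|ch_fwd c x - ch_fwd c e| <= r ->
     ch_dom c (mul x x) /\
     `|ch_fwd c (mul x x) - ch_fwd c e - (ch_fwd c x - ch_fwd c e) *+ 2| <=
       2^-1 * `|ch_fwd c x - ch_fwd c e|)].
Proof.
have [_ [_ emul mule _ _] mulc _ [n [At [[Ac Ae _] Amul _]]]] := lieT.
have [c Atc ce] := Ae e; have cc := Ac c Atc; have [odom oimg bf fc bc] := cc.
set p0 := ch_fwd c e.
have ip0 : chart_img c p0 by exists e.
have bp0 : ch_bwd c p0 = e by exact: bf.
pose F (z : 'rV[RR]_(n + n)) := ch_fwd c (mul (ch_bwd c (lsubmx z)) (ch_bwd c (rsubmx z))).
have smF := Amul c c c Atc Atc Atc.
set Om := [set z : 'rV[RR]_(n + n) | _] in smF.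
pose z0 := row_mx p0 p0.
have lz0 : lsubmx z0 = p0 by rewrite row_mxKl.
have rz0 : rsubmx z0 = p0 by rewrite row_mxKr.
have lc := @lsubmx_continuous RR n n z0; rewrite /continuous_at lz0 in lc.
have rc := @rsubmx_continuous RR n n z0; rewrite /continuous_at rz0 in rc.
have nimg : nbhs p0 (chart_img c) by exact: open_nbhs_nbhs.
have bc0 : ch_bwd c @ p0 --> e by rewrite -[X in _ --> X]bp0; exact: bc.
have nOm : nbhs z0 Om.
  have cl : (fun z : 'rV[RR]_(n + n) => ch_bwd c (lsubmx z)) @ z0 --> e by exact: cvg_comp lc bc0.
  have cr : (fun z : 'rV[RR]_(n + n) => ch_bwd c (rsubmx z)) @ z0 --> e by exact: cvg_comp rc bc0.
  have cm : (fun z : 'rV[RR]_(n + n) => mul (ch_bwd c (lsubmx z)) (ch_bwd c (rsubmx z))) @ z0 --> e.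
    rewrite -[X in _ --> X](mule e).
    exact: (@cvg_comp _ _ _ (fun z => (ch_bwd c (lsubmx z), ch_bwd c (rsubmx z)))
      (fun q : T * T => mul q.1 q.2) _ _ _ (cvg_pair cl cr) (mulc (e, e))).
  have nd : nbhs e (ch_dom c) by exact: open_nbhs_nbhs.
  have n1 : \forall z \near z0, chart_img c (lsubmx z) by exact: lc.
  have n2 : \forall z \near z0, chart_img c (rsubmx z) by exact: rc.
  have n3 : \forall z \near z0, ch_dom c (mul (ch_bwd c (lsubmx z)) (ch_bwd c (rsubmx z))).
    exact: cm.
  by apply: filterS3 n1 n2 n3 => z.
have Om0 : Om z0 by exact: nbhs_singleton.
(* Two increments are compared below; with this [ep] each has error at most |h|/4. The successor
   avoids dividing by zero when [n = 0]. *)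
pose ep : RR := (4 * (n + n).+1%:R)^-1.
have ep0 : 0 < ep by rewrite invr_gt0 mulr_gt0// ltr0n.
have nD : \forall z \near z0, forall k : 'I_(n + n), derivable F z (delta_mx 0 k) /\
     `|'D_(delta_mx 0 k) F z - 'D_(delta_mx 0 k) F z0| <= ep.
  apply: (@filter_forall _ _ (fun k z => derivable F z (delta_mx 0 k) /\
     `|'D_(delta_mx 0 k) F z - 'D_(delta_mx 0 k) F z0| <= ep) (nbhs z0)) => k.
  have [_ cD] := smF [:: delta_mx 0 k]; have {}cD := cD _ Om0; rewrite /= in cD.
  have cD' : \forall z \near z0, `|'D_(delta_mx 0 k) F z - 'D_(delta_mx 0 k) F z0| <= ep.
    by apply: (@cvgr_distC_le _ _ _ _ _ _ _ cD).
  apply: (@filterS2 _ (nbhs z0) (nbhs_filter z0) Om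
    (fun z => `|'D_(delta_mx 0 k) F z - 'D_(delta_mx 0 k) F z0| <= ep) _ _ nOm cD').
  move=> z Oz Dz; split; last exact: Dz.
  by have [+ _] := smF [::]; apply.
have [r r0 rP] : exists2 r : RR, 0 < r & forall z, `|z - z0| < r -> (forall k : 'I_(n + n),
    derivable F z (delta_mx 0 k) /\ `|'D_(delta_mx 0 k) F z - 'D_(delta_mx 0 k) F z0| <= ep) /\ Om z.
  have [r /= r0 rP] := (@nbhs_normP RR 'rV[RR]_(n + n) z0 _).1 (filterI nD nOm); exists r => // z zr.
  by apply: rP; rewrite /= distrC.
have nz (u v : 'rV[RR]_n) (M : RR) : `|u - p0| <= M -> `|v - p0| <= M -> `|row_mx u v - z0| <= M.
  by move=> uM vM; rewrite opp_row_mx add_row_mx; exact: row_mx_norm.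
have r40 : 0 < r / 4 by rewrite divr_gt0.
have r4r : r / 4 < r by lra.
exists n, c, (r / 4); split => //.
  move=> y yr; have [|_ []] := rP (row_mx y p0); last by rewrite row_mxKl.
  by apply: le_lt_trans (nz _ _ _ yr _) r4r; rewrite subrr normr0 ltW.
move=> x cx xr; set h := ch_fwd c x - p0 in xr *.
have xE : ch_fwd c x = p0 + h by rewrite addrC subrK.
have bx : ch_bwd c (p0 + h) = x by rewrite -xE bf.
have [|_ [_ [_]]] := rP (row_mx (p0 + h) (p0 + h)).
  by apply: le_lt_trans (nz _ _ _ _ _) r4r; rewrite addrC addKr.
rewrite row_mxKl row_mxKr bx => dxx; split=> //.
have rP1 (y : 'rV[RR]_(n + n)) (k : 'I_(n + n)) : `|y - z0| < r -> derivable F y (delta_mx 0 k) /\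
     `|'D_(delta_mx 0 k) F y - 'D_(delta_mx 0 k) F z0| <= ep by move=> /rP[].
(* Moving the first factor by [h] has nearly the same effect from [zA] as from [z0], where it is
   exactly [h]; hence the chart value of [mul x x] is nearly [p0 + h + h]. *)
pose zA := row_mx p0 (p0 + h); pose dh : 'rV[RR]_(n + n) := row_mx h 0.
have hh : `|dh| <= `|h| by apply: row_mx_norm; rewrite ?normr0.
have zAr : `|zA - z0| <= `|h| by apply: nz; rewrite ?subrr ?normr0// addrC addKr.
have [|iA] := pselect (`|zA - z0| + 2 * `|dh| < r); last by exfalso; apply: iA; lra.
move=> /(increment_bound (ltW ep0) rP1) iA.
have [|iB] := pselect (`|z0 - z0| + 2 * `|dh| < r); last by exfalso; apply: iB; rewrite subrr normr0; lra.
move=> /(increment_bound (ltW ep0) rP1) iB.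
have FA1 : F (zA + dh) = ch_fwd c (mul x x).
  by rewrite /F /zA /dh add_row_mx row_mxKl row_mxKr addr0 bx.
have FA : F zA = p0 + h by rewrite /F /zA row_mxKl row_mxKr bx bp0 emul xE.
have FB1 : F (z0 + dh) = p0 + h.
  by rewrite /F /z0 /dh add_row_mx row_mxKl row_mxKr addr0 bx bp0 mule xE.
have FB : F z0 = p0 by rewrite /F row_mxKl row_mxKr bp0 emul.
rewrite FA1 FA in iA; rewrite FB1 FB in iB.
set Sg := \sum_k _ in iA iB.
have -> : ch_fwd c (mul x x) - p0 - h *+ 2 = (ch_fwd c (mul x x) - (p0 + h) - Sg) - (p0 + h - p0 - Sg).
  rewrite [p0 + h]addrC addrK opprB addrA subrK.
  by rewrite mulr2n [h + p0]addrC !opprD !addrA.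
apply: le_trans (ler_normB _ _) _; apply: le_trans (lerD iA iB) _.
have nep : (n + n)%:R * ep <= 4^-1.
  rewrite /ep invfM mulrCA -[X in _ <= X]mulr1 ler_wpM2l//.
  by rewrite ler_pdivrMr ?ltr0n// mul1r ler_nat.
have := normr_ge0 h; move: hh nep; have := normr_ge0 dh.
move: ((n + n)%:R * ep) => q; nra.
Qed.

Lemma lie_compact_nbhs : exists2 K, compact K & nbhs e K.
Proof.
have [n [c [r [[odom oimg bf fc bc] ce r0 rimg _]]]] := lie_chart_square.
set p0 := ch_fwd c e in rimg.
pose B := closed_ball_ (@Num.Def.normr RR 'rV[RR]_n) p0 r.
have cB : compact B.
  apply: bounded_closed_compact; last exact: closed_closed_ball_.
  exists (`|p0| + r); split; first exact: num_real.
  move=> M pM y /= yr; rewrite -[y](subKr p0).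
  have := ler_normB p0 (p0 - y); have : `|p0 - y| <= r by [].
  move: pM; move: (`|p0|) (`|p0 - y|) (`|p0 - (p0 - y)|) => a b q; lra.
have BI : B `<=` chart_img c by move=> y yB; apply: rimg; rewrite distrC.
exists (ch_bwd c @` B).
  apply: continuous_compact => //; apply: continuous_in_subspaceT => y.
  by rewrite inE => /BI; exact: bc.
have nd : nbhs e (ch_dom c) by exact: open_nbhs_nbhs.
have nB : nbhs p0 B.
  by apply/(@nbhs_normP RR 'rV[RR]_n); exists r => //= y /ltW.
have nf : nbhs e [set x | B (ch_fwd c x)] by exact: (fc e ce _ nB).
by apply: filterS (filterI nd nf) => x [dx Bx]; exists (ch_fwd c x) => //; exact: bf.
Qed.

(** Squaring multiplies the distance to [e] in the chart by at least 3/2, so iterated squares of an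
    element other than [e] leave the ball of radius [r]. *)
Lemma lie_no_small_subgroup : exists2 W, nbhs e W &
  forall S, subgroup mul inv e S -> S `<=` W -> S `<=` [set e].
Proof.
have [n [c [r [[odom oimg bf fc bc] ce r0 _ rsq]]]] := lie_chart_square.
set p0 := ch_fwd c e in rsq.
exists [set x | ch_dom c x /\ `|ch_fwd c x - p0| <= r].
  have nB : nbhs p0 [set y | `|y - p0| <= r].
    by apply/(@nbhs_normP RR 'rV[RR]_n); exists r => //= y /ltW; rewrite distrC.
  have nf : nbhs e [set x | `|ch_fwd c x - p0| <= r] by exact: (fc e ce _ nB).
  by apply: filterI => //; exact: open_nbhs_nbhs.
move=> S [_ SM _] SW x Sx /=.
have [dx _] := SW _ Sx.
suff : `|ch_fwd c x - p0| <= 0.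
  by rewrite normr_le0 subr_eq0 => /eqP xp; rewrite -(bf _ dx) xp bf.
rewrite leNgt; apply/negP; set dl := `|_ - _| => dl0.
(* A lower bound linear in [k] is enough to exceed [r]. *)
have grow k : exists2 y, S y & dl * (1 + k%:R / 2) <= `|ch_fwd c y - p0|.
  elim: k => [|k [y Sy yk]]; first by exists x => //; rewrite mul0r addr0 mulr1.
  exists (mul y y); first exact: SM.
  have [dy yr] := SW _ Sy; have [_ sq] := rsq _ dy yr.
  have : `|(ch_fwd c y - p0) *+ 2| <= `|ch_fwd c (mul y y) - p0| + 2^-1 * `|ch_fwd c y - p0|.
    have := ler_normB (ch_fwd c (mul y y) - p0)
      (ch_fwd c (mul y y) - p0 - (ch_fwd c y - p0) *+ 2).
    by rewrite subKr => h0; apply: le_trans h0 _; rewrite lerD2l.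
  rewrite normrMn mulr2n -[k.+1%:R]natr1 => h1; have : 0 <= dl * k%:R by rewrite mulr_ge0// ltW.
  move: h1 yk dl0; rewrite -/dl; move: dl => D.
  move: (`|ch_fwd c y - p0|) (`|ch_fwd c (mul y y) - p0|) (k%:R : RR) => a b q; lra.
have [y Sy] := grow (Num.truncn (2 * r / dl)).+1.
have [_ yr] := SW _ Sy.
have := truncnS_gt (2 * r / dl); rewrite ltr_pdivrMr//; clear grow.
move: (Num.truncn _).+1 => N Ngt Nle; move: Ngt Nle yr dl0; rewrite -/dl; move: dl => D.
move: (`|ch_fwd c y - p0|) (N%:R : RR) => a q; nra.
Qed.

End LieLocal.

End LieGroups.

Local Open Scope quotient_scope.
Local Open Scope group_scope.

(** * Nilpotent groups *)

Ltac gsimp := rewrite /conjg /commg;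
  repeat progress rewrite ?(invgM, invgK, invg1, mulgA, mulg1, mul1g, mulgV, mulVg, mulgK, mulgVK).

Notation sgp := (subgroup (@monoid.mul _) (@monoid.inv _) 1).
Notation genS := (gen (@monoid.mul _) (@monoid.inv _) 1).

Section Subgroups.
Variable G : groupType.
Implicit Types (A B H N S : set G) (x y z : G).

Lemma sgp1 H : sgp H -> H 1. Proof. by case. Qed.
Lemma sgpM H x y : sgp H -> H x -> H y -> H (x * y).
Proof. by case=> _ HM _; exact: HM. Qed.
Lemma sgpV H x : sgp H -> H x -> H x^-1.
Proof. by case=> _ _ HV; exact: HV. Qed.
Lemma sgpVE H x : sgp H -> H x^-1 -> H x.
Proof. by move=> HH /(sgpV HH); rewrite invgK. Qed.
Lemma sgpJ H x y : sgp H -> H x -> H y -> H (x ^ y).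
Proof. by move=> HH Hx Hy; apply: sgpM => //; [exact: sgpV|exact: sgpM]. Qed.
Lemma sgpR H x y : sgp H -> H x -> H y -> H [~ x, y].
Proof. by move=> HH Hx Hy; rewrite commgEl; apply: sgpM => //; [exact: sgpV|exact: sgpJ]. Qed.
Lemma sgpMl H x y : sgp H -> H x -> H (x * y) -> H y.
Proof. by move=> HH Hx /(sgpM HH (sgpV HH Hx)); rewrite mulgA mulVg mul1g. Qed.
Lemma sgpMr H x y : sgp H -> H y -> H (x * y) -> H x.
Proof. by move=> HH Hy Hxy; have := sgpM HH Hxy (sgpV HH Hy); rewrite mulgK. Qed.
Lemma sgpX H x n : sgp H -> H x -> H (x ^+ n).
Proof.
move=> HH Hx; elim: n => [|n IH]; first by rewrite expg0; exact: sgp1.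
by rewrite expgS; exact: sgpM.
Qed.

Lemma sgp_set1 : sgp ([set 1] : set G).
Proof. by split=> //= [x y -> ->|x ->]; rewrite ?mulg1 ?invg1. Qed.

Lemma sgpI A B : sgp A -> sgp B -> sgp (A `&` B).
Proof.
move=> HA HB; split=> [|x y [? ?] [? ?]|x [? ?]]; first by split; exact: sgp1.
  by split; exact: sgpM.
by split; exact: sgpV.
Qed.

Lemma gen_sgp S : sgp (genS S).
Proof.
split=> [H /sgp1 //|x y Sx Sy H HH SH|x Sx H HH SH].
  by apply: sgpM => //; [exact: Sx|exact: Sy].
by apply: sgpV => //; exact: Sx.
Qed.

Lemma sub_gen S : S `<=` genS S.
Proof. by move=> x Sx H _; apply. Qed.

Lemma gen_sub S H : sgp H -> S `<=` H -> genS S `<=` H.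
Proof. by move=> HH SH x; apply. Qed.

Definition normalizes A H := forall x y, A x -> H y -> A (x ^ y).

Fixpoint ucs H (l : nat) : set G :=
  if l is l'.+1 then [set x | H x /\ forall y, H y -> ucs H l' [~ x, y]] else [set 1].

Section Ucs.
Variables (H : set G) (HH : sgp H).

Lemma ucs_sub l : ucs H l `<=` H.
Proof. by case: l => [x ->|l x []//]; exact: sgp1. Qed.

Lemma ucs_group l : sgp (ucs H l) /\ normalizes (ucs H l) H.
Proof.
elim: l => [|l [IH IJ]].
  by split; [exact: sgp_set1|move=> x y ->; rewrite conj1g].
have Zinv x : ucs H l.+1 x -> ucs H l.+1 x^-1.
  move=> [Hx Zx]; split=> [|y Hy]; first exact: sgpV.
  have -> : [~ x^-1, y] = ([~ x, y]^-1) ^ x^-1 by gsimp.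
  by apply: IJ; [apply: sgpV => //; exact: Zx|exact: sgpV].
split=> [|x h [Hx Zx] Hh]; last first.
  split=> [|y Hy]; first exact: sgpJ.
  have -> : [~ x ^ h, y] = [~ x, y ^ h^-1] ^ h by gsimp.
  by apply: IJ => //; apply: Zx; apply: sgpJ => //; exact: sgpV.
split=> [||//].
  by split=> [|y Hy]; rewrite ?comm1g; exact: sgp1.
move=> x x' [Hx Zx] [Hx' Zx']; split=> [|y Hy]; first exact: sgpM.
have -> : [~ x * x', y] = [~ x, y] ^ x' * [~ x', y] by gsimp.
by apply: sgpM => //; [apply: IJ => //; exact: Zx|exact: Zx'].
Qed.

Lemma ucs_sgp l : sgp (ucs H l). Proof. by have [] := ucs_group l. Qed.

Lemma ucsJ l x h : ucs H l x -> H h -> ucs H l (x ^ h).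
Proof. by have [_] := ucs_group l; apply. Qed.

Lemma ucsR l x y : ucs H l.+1 x -> H y -> ucs H l [~ x, y].
Proof. by case=> _; apply. Qed.

Lemma ucsS l : ucs H l `<=` ucs H l.+1.
Proof.
move=> x Zx; split=> [|y Hy]; first exact: ucs_sub Zx.
by rewrite commgEl; apply: sgpM; [exact: ucs_sgp|apply: sgpV => //; exact: ucs_sgp|exact: ucsJ].
Qed.

Lemma ucs_le l m : l <= m -> ucs H l `<=` ucs H m.
Proof.
by move=> /subnK <-; elim: (m - l)%N => [//|k IH] x /IH; exact: ucsS.
Qed.

(* Stability group of the upper central series; it turns [ucs] into a
   filtration in which commutators add up degrees. *)
Definition stab d j : set G :=
  [set x | ucs H (d.+1 - j) x /\ forall l y, ucs H l y -> ucs H (l - j) [~ x, y]].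

Lemma stab_sub d j : stab d j `<=` H.
Proof. by move=> x [/ucs_sub]. Qed.

Lemma stab_sgp d j : sgp (stab d j).
Proof.
split.
- split; first exact: sgp1 (ucs_sgp _).
  by move=> l y _; rewrite comm1g; exact: sgp1 (ucs_sgp _).
- move=> x x' [Zx Cx] [Zx' Cx']; split; first exact: sgpM (ucs_sgp _) Zx Zx'.
  move=> l y Zy; have -> : [~ x * x', y] = [~ x, y] ^ x' * [~ x', y] by gsimp.
  apply: sgpM (ucs_sgp _) _ (Cx' _ _ Zy); apply: ucsJ (Cx _ _ Zy) _.
  exact: ucs_sub Zx'.
- move=> x [Zx Cx]; split; first exact: sgpV (ucs_sgp _) Zx.
  move=> l y Zy; have -> : [~ x^-1, y] = ([~ x, y]^-1) ^ x^-1 by gsimp.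
  apply: ucsJ; first exact: sgpV (ucs_sgp _) (Cx _ _ Zy).
  by apply: sgpV => //; exact: ucs_sub Zx.
Qed.

(** A three-subgroup argument: taking commutators with [x] and [y], in either order, lowers the
    level in [ucs] by [i + j]. *)
Lemma stab_comm d i j x y : stab d i x -> stab d j y -> stab d (i + j) [~ x, y].
Proof.
move=> Sx Sy; have [Zx Cx] := Sx; have [Zy Cy] := Sy.
split=> [|l w Zw]; first by rewrite addnC subnDA; exact: Cx.
have Hx := ucs_sub Zx; have Hy := ucs_sub Zy; have Hw := ucs_sub Zw.
have HV u : H u -> H u^-1 by exact: sgpV.
have ZV q u : ucs H q u -> ucs H q u^-1 by move=> ?; apply: sgpV => //; exact: ucs_sgp.
have [_ _ SV] := stab_sgp d i; have [_ Cx'] := SV _ Sx.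
have [_ _ SVy] := stab_sgp d j; have [_ Cy'] := SVy _ Sy.
(* Hall--Witt *)
have -> : [~ [~ x, y], w] =
  (([~ [~ y^-1, w^-1], x] ^ w * [~ [~ w, x^-1], y^-1] ^ x) ^-1) ^ y by gsimp.
have Zw2 : ucs H l w^-1 by exact: ZV.
have A1 : ucs H (l - (i + j)) [~ [~ y^-1, w^-1], x].
  rewrite -invgR; apply: (ZV _ _ _); rewrite addnC subnDA; apply: Cx; exact: Cy'.
have A2 : ucs H (l - (i + j)) [~ [~ w, x^-1], y^-1].
  rewrite -invgR; apply: (ZV _ _ _); rewrite subnDA; apply: Cy'; rewrite -invgR; apply: (ZV _ _ _); exact: Cx'.
apply: ucsJ => //; apply: (ZV _ _ _); apply: sgpM; [exact: ucs_sgp|exact: ucsJ|exact: ucsJ].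
Qed.

(** The offset [d.+1] in [stab] is chosen for this: level [d.+1 - 1] is all of [H], while degree
    [d.+1] is trivial. *)
Lemma stab01 d i : H `<=` ucs H d -> (i <= 1)%N -> H `<=` stab d i.
Proof.
move=> Hd i1 x Hx; split.
  by apply: (@ucs_le d); [case: i i1 => [|[|]]//=; rewrite ?subSS ?subn0|exact: Hd].
case: i i1 => [|[|//]] _ l y Zy.
  have ZVy := sgpV (ucs_sgp l) Zy; rewrite subn0 commgEr.
  by apply: sgpM (ucs_sgp _) _ Zy; exact: ucsJ.
case: l Zy => [|l] Zy; first by rewrite Zy commg1.
by rewrite subn1 -invgR; apply: sgpV; [exact: ucs_sgp|exact: ucsR].
Qed.

Lemma stab_top d j : (d < j)%N -> stab d j `<=` [set 1].
Proof. by move=> dj x [+ _]; have /eqP -> : (d.+1 - j == 0)%N by rewrite subn_eq0. Qed.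

Lemma stab_le d i j : (i <= j)%N -> stab d j `<=` stab d i.
Proof.
move=> ij x [Zx Cx]; split; first by apply: ucs_le Zx; exact: leq_sub2l.
by move=> l y /Cx; apply: ucs_le; exact: leq_sub2l.
Qed.

End Ucs.

(** By induction on [l], term [d - l] of the lower central series of the whole group meets [H]
    inside level [l] of the upper central series of [H]. *)
Lemma lcs_ucs H d : sgp H -> lcs (@monoid.mul G) (@monoid.inv G) 1 d = [set 1] ->
  H `<=` ucs H d.
Proof.
move=> HH Ld; suff : forall l, (l <= d)%N ->
    lcs (@monoid.mul G) (@monoid.inv G) 1 (d - l) `&` H `<=` ucs H l.
  by move=> /(_ d (leqnn _)); rewrite subnn => + x Hx; apply; split.
elim=> [|l IH] ld x [Lx Hx]; first by move: Lx; rewrite subn0 Ld.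
split=> // y Hy; rewrite -invgR; apply: sgpV; first exact: ucs_sgp.
apply: IH; first exact: ltnW.
split; last exact: sgpR.
rewrite -(subnSK ld); apply: sub_gen.
by exists y, x; split=> //; rewrite /commutator /commg /conjg !mulgA.
Qed.

End Subgroups.

(** * Noetherian nilpotent groups *)

Section Noetherian.
Variable G : groupType.
Implicit Types (A B H : set G) (x y z : G).

Definition fingen H := exists2 s : seq G, [set` s] `<=` H & H `<=` genS [set` s].

Definition noetherian A := forall H, sgp H -> H `<=` A -> fingen H.

Lemma gen_mono A B : A `<=` B -> genS A `<=` genS B.
Proof. by move=> AB; apply: gen_sub; [exact: gen_sgp|move=> x /AB; exact: sub_gen]. Qed.

(** The products [s ^- m * s ^+ n] stand for integer powers of [s]. A subgroup [H] is generated by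
    generators of its intersection with [A] and one element whose exponent of [s] is the least
    positive one, by division with remainder. *)
Lemma noetherian_cyclic_ext A B s : sgp A -> normalizes A [set s ^+ n | n in setT] ->
  (forall x, B x -> exists m n a, A a /\ x = s ^- m * s ^+ n * a) ->
  noetherian A -> noetherian B.
Proof.
move=> HA An Bs NA H HH HB.
have AX x n : A x -> A (x ^ (s ^+ n)) by move=> Ax; apply: An => //; exists n.
have [t tHA HAt] := NA (H `&` A) (sgpI HH HA) (@subIsetr _ _ _).
pose good n := `[< exists a, A a /\ H (s ^+ n.+1 * a) >].
have [u uH Hu] : exists2 u : seq G, [set` u] `<=` H &
    forall k a, A a -> H (s ^+ k * a) -> genS [set` u] (s ^+ k * a).
  have [/asboolP ex|nex] := boolP `[< exists n, good n >].
    case: (ex_minnP ex) => n0 /asboolP[a0 [Aa0 Ha0]] n0min.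
    exists (s ^+ n0.+1 * a0 :: t).
      by move=> x /=; rewrite inE => /orP[/eqP->//|/tHA[]].
    elim/ltn_ind => -[|k] IH a Aa Hk.
      rewrite expg0 mul1g in Hk *; have /HAt := conj Hk Aa.
      by apply: gen_mono => x /= xt; rewrite inE xt orbT.
    have n0k : (n0 <= k)%N by apply: n0min; apply/asboolP; exists a.
    set h0 := s ^+ n0.+1 * a0 in Ha0 *.
    have E : s ^+ k.+1 * a = h0 * (s ^+ (k - n0) * ((a0^-1) ^ (s ^+ (k - n0)) * a)).
      have -> : s ^+ k.+1 = s ^+ n0.+1 * s ^+ (k - n0) by rewrite -expgnDr addSn subnKC.
      by rewrite /h0; gsimp.
    have Aa' : A ((a0^-1) ^ (s ^+ (k - n0)) * a) by apply: sgpM => //; apply: AX; exact: sgpV.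
    rewrite E in Hk *.
    apply: (sgpM (gen_sgp _)).
      by apply: sub_gen => /=; rewrite inE eqxx.
    apply: IH => //; first by rewrite ltnS leq_subr.
    exact: sgpMl HH Ha0 Hk.
  exists t; first by move=> x /tHA[].
  move=> [|k] a Aa Hk; first by rewrite expg0 mul1g in Hk *; apply: HAt.
  by case/negP: nex; apply/asboolP; exists k; apply/asboolP; exists a.
(* An element with negative exponent of [s] is reached through its inverse. *)
exists u => // x Hx; have [m [n [a [Aa xE]]]] := Bs x (HB _ Hx).
have [mn|/ltnW nm] := leqP m n.
  have E : x = s ^+ (n - m) * a.
    by rewrite xE -(subnKC mn) expgnDr addKn mulKg.
  by rewrite E in Hx *; exact: Hu.
have E : x^-1 = s ^+ (m - n) * (a^-1 ^ (s ^+ (m - n))).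
  by rewrite xE -(subnKC nm) expgnDr addKn; gsimp.
rewrite -[x]invgK; apply: (sgpV (gen_sgp _)).
have Hx' := sgpV HH Hx; rewrite E in Hx' *; apply: Hu => //.
by apply: AX; exact: sgpV.
Qed.

(** Lower central series of the subgroup [H] itself, whereas [lcs] is that of the whole group. *)
Fixpoint rlcs H j : set G :=
  if j is j'.+1 then
    genS [set z | exists x y, [/\ H x, rlcs H j' y & z = [~ x, y]]] else H.

Section Rlcs.
Variables (H : set G) (HH : sgp H).

Lemma rlcs_sgp j : sgp (rlcs H j).
Proof. by case: j => [|j] //; exact: gen_sgp. Qed.

Lemma rlcs_normal j : normalizes (rlcs H j) H.
Proof.
elim: j => [|j IH] x h /=; first exact: sgpJ.
move=> Lx Hh; suff : rlcs H j.+1 `<=` [set x | rlcs H j.+1 (x ^ h)] by apply.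
apply: gen_sub.
  split=> [|u v|u] /=; first by rewrite conj1g; exact: sgp1 (gen_sgp _).
    by rewrite conjMg; exact: sgpM (gen_sgp _).
  by rewrite conjVg; exact: sgpV (gen_sgp _).
move=> _ [u [v [Hu Lv ->]]] /=; rewrite conjRg; apply: sub_gen.
by exists (u ^ h), (v ^ h); split=> //; [exact: sgpJ|exact: IH].
Qed.

Lemma rlcsS j : rlcs H j.+1 `<=` rlcs H j.
Proof.
apply: gen_sub; first exact: rlcs_sgp.
move=> _ [x [y [Hx Ly ->]]]; rewrite commgEr; apply: (sgpM (rlcs_sgp j) _ Ly).
by apply: rlcs_normal => //; exact: sgpV (rlcs_sgp j) Ly.
Qed.

Lemma rlcs_sub j : rlcs H j `<=` H.
Proof. by elim: j => [//|j IH] x /rlcsS /IH. Qed.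

Lemma rlcsR j x y : H x -> rlcs H j y -> rlcs H j.+1 [~ x, y].
Proof. by move=> Hx Ly; apply: sub_gen; exists x, y. Qed.

Lemma rlcs_mid_normal j A : sgp A -> rlcs H j.+1 `<=` A -> A `<=` rlcs H j ->
  normalizes A H.
Proof.
move=> HA LA AL x h Ax Hh; have -> : x ^ h = x * [~ h, x]^-1 by gsimp.
by apply: sgpM => //; apply: sgpV => //; apply: LA; apply: rlcsR => //; exact: AL.
Qed.

(** Modulo the next term the commutator is multiplicative in each argument, so commutators of
    generators generate. *)
Lemma rlcs_fingen j : fingen H -> exists2 s : seq G, [set` s] `<=` rlcs H j &
  rlcs H j `<=` genS ([set` s] `|` rlcs H j.+1).
Proof.
move=> [F FH HF]; elim: j => [|j [S SL LS]].
  by exists F => // x /HF; apply: gen_mono => y; left.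
have RS : [set` [seq [~ f, s] | f <- F, s <- S]] `<=` rlcs H j.+1.
  by move=> _ /= /allpairsP[[f s] /= [fF sS ->]]; apply: rlcsR; [exact: FH|exact: SL].
exists [seq [~ f, s] | f <- F, s <- S] => //.
set B := genS _; have HB : sgp B by exact: gen_sgp.
have BL : B `<=` rlcs H j.+1.
  by apply: gen_sub; [exact: rlcs_sgp|move=> x [/RS//|/rlcsS]].
have BJ : normalizes B H.
  by apply: (@rlcs_mid_normal j.+1) => // x Lx; apply: sub_gen; right.
have BS s : s \in S -> H `<=` [set x | H x /\ B [~ x, s]].
  move=> sS x Hx; have Hs := rlcs_sub (SL _ sS); move: (HF _ Hx) => {Hx}; move: x; apply: gen_sub.
    split=> [|x x' [Hx0 Bx] [Hx' Bx']|x [Hx0 Bx]] /=.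
    - by split; [exact: sgp1|rewrite comm1g; exact: sgp1 HB].
    - split; first exact: sgpM.
      have -> : [~ x * x', s] = [~ x, s] ^ x' * [~ x', s] by gsimp.
      by apply: (sgpM HB) => //; exact: BJ.
    - split; first exact: sgpV.
      have -> : [~ x^-1, s] = ([~ x, s]^-1) ^ x^-1 by gsimp.
      by apply: BJ; [exact: sgpV HB _|exact: sgpV].
  move=> f fF; split; first exact: FH.
  by apply: sub_gen; left; apply/allpairsP; exists (f, s).
apply: gen_sub => // _ [x [y [Hx Ly ->]]].
suff : rlcs H j `<=` [set y | rlcs H j y /\ B [~ x, y]] by move=> /(_ _ Ly)[].
move=> {y Ly} y /LS; move: y; apply: gen_sub.
  split=> [|y y' [Ly By] [Ly' By']|y [Ly By]] /=.
  - by split; [exact: sgp1 (rlcs_sgp _)|rewrite commg1; exact: sgp1 HB].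
  - split; first exact: sgpM (rlcs_sgp _) Ly Ly'.
    have -> : [~ x, y * y'] = [~ x, y'] * [~ x, y] ^ y' by gsimp.
    by apply: (sgpM HB) => //; apply: BJ => //; exact: rlcs_sub Ly'.
  - have LyV := sgpV (rlcs_sgp _) Ly; split=> //.
    have -> : [~ x, y^-1] = ([~ x, y]^-1) ^ y^-1 by gsimp.
    by apply: BJ; [exact: sgpV HB _|exact: rlcs_sub LyV].
move=> y [yS|Ly]; first by split; [exact: SL|have [] := BS _ yS _ Hx].
by split; [exact: rlcsS|apply: sub_gen; right; exact: rlcsR].
Qed.

Lemma noetherian_sub A B : A `<=` B -> noetherian B -> noetherian A.
Proof. by move=> AB NB C HC CA; apply: NB => // x /CA /AB. Qed.

(** Climbing from the trivial term up to [H], the generators of each term over the next are added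
    one at a time, each by a cyclic extension. *)
Lemma noetherian_nilpotent d : fingen H -> rlcs H d `<=` [set 1] -> noetherian H.
Proof.
move=> fgH Ld; suff : forall j, (j <= d)%N -> noetherian (rlcs H (d - j)).
  by move=> /(_ d (leqnn _)); rewrite subnn.
elim=> [_|j IH jd].
  rewrite subn0 => A HA AL; exists [::] => // x /AL/Ld ->; exact: sgp1 (gen_sgp _).
have {}IH := IH (ltnW jd); rewrite -(subnSK jd) in IH; move: (d - j.+1)%N IH => k IH.
have [S SL LS] := rlcs_fingen k fgH; apply: noetherian_sub LS _.
elim: S SL => [|s S IHS] SL.
  by apply: noetherian_sub IH; apply: gen_sub; [exact: rlcs_sgp|move=> x []].
have SL' : [set` S] `<=` rlcs H k by move=> x /= xS; apply: SL; rewrite /= inE xS orbT.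
have Ls : rlcs H k s by apply: SL; rewrite /= inE eqxx.
have Hs := rlcs_sub Ls.
set A := genS ([set` S] `|` rlcs H k.+1); have HA : sgp A by exact: gen_sgp.
have AJ : normalizes A H.
  apply: (@rlcs_mid_normal k) => //; first by move=> x Lx; apply: sub_gen; right.
  by apply: gen_sub; [exact: rlcs_sgp|move=> x [/SL'|/rlcsS]].
have HX n : H (s ^+ n) by exact: sgpX.
apply: (@noetherian_cyclic_ext A _ s) => //; last exact: IHS.
  by move=> x _ Ax [n _ <-]; exact: AJ.
apply: (@gen_sub _ _ [set x | exists m n a, A a /\ x = s ^- m * s ^+ n * a]).
  split=> [|x y|x].
  - by exists 0%N, 0%N, 1; split; [exact: sgp1 HA|rewrite expg0; gsimp].
  - move=> [m [n [a [Aa ->]]]] [m' [n' [a' [Aa' ->]]]].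
    exists (m + m'), (n + n'), (a ^ (s ^- m' * s ^+ n') * a').
    split.
      apply: (sgpM HA) => //; apply: AJ => //; apply: (sgpM HH) => //; exact: sgpV.
    have E : s ^- m' * s ^+ n = s ^+ n * s ^- m'.
      by apply: commute_sym; apply: commuteV; apply: commuteX2.
    have -> : s ^- (m + m') = s ^- m * s ^- m' by rewrite addnC expgnDr invgM.
    rewrite expgnDr -[s ^- m * s ^- m' * _]mulgA [s ^- m' * (_ * _)]mulgA E.
    by gsimp.
  - move=> [m [n [a [Aa ->]]]].
    exists n, m, ((a^-1) ^ (s ^- n * s ^+ m)); split.
      by apply: AJ; [exact: sgpV HA _|apply: (sgpM HH) => //; exact: sgpV].
    by gsimp.
move=> x [|Lx].
  rewrite /= inE => /orP[/eqP->|xS].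
    by exists 0%N, 1%N, 1; split; [exact: sgp1 HA|rewrite expg0 expg1; gsimp].
  exists 0%N, 0%N, x; split; last by rewrite expg0; gsimp.
  by apply: sub_gen; left.
exists 0%N, 0%N, x; split; last by rewrite expg0; gsimp.
by apply: sub_gen; right.
Qed.

Lemma rlcs_lcs j : rlcs H j `<=` lcs (@monoid.mul G) (@monoid.inv G) 1 j.
Proof.
elim: j => [//|j IH]; apply: gen_sub; first exact: gen_sgp.
move=> _ [x [y [Hx Ly ->]]]; apply: sub_gen.
by exists x, y; split; [exact: IH|rewrite /commutator /commg /conjg !mulgA].
Qed.

End Rlcs.
End Noetherian.

(** * Host-Kra cubes of a filtration *)

Section Cubes.
Variables (G : groupType) (N : nat -> set G).
Hypothesis Nsg : forall i, sgp (N i).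
Hypothesis Nle : forall i j, (i <= j)%N -> N j `<=` N i.
Hypothesis Ncomm : forall i j x y, N i x -> N j y -> N (i + j) [~ x, y].

Implicit Types (c u v : seq bool -> G).

Definition cmul u v : seq bool -> G := fun w => u w * v w.
Definition cinv u : seq bool -> G := fun w => (u w)^-1.
Definition face b u : seq bool -> G := fun w => u (b :: w).

(* Host-Kra cubes of dimension n for the filtration shifted by s: a cube is a
   pair of opposite facets c0, c0 c1 with c1 of one degree more. *)
Fixpoint HK n s c : Prop :=
  if n is n'.+1 then
    HK n' s (face false c) /\ HK n' s.+1 (cmul (cinv (face false c)) (face true c))
  else N s (c [::]).

Lemma HK_ext n s u v : (forall w, size w = n -> u w = v w) -> HK n s u -> HK n s v.
Proof.
elim: n s u v => [|n IH] s u v uv /=; first by rewrite uv.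
case=> U0 U1; split.
  by apply: IH U0 => w wn; rewrite /face uv//= wn.
by apply: IH U1 => w wn; rewrite /cmul /cinv /face !uv//= wn.
Qed.

Lemma HK_le n s t u : (s <= t)%N -> HK n t u -> HK n s u.
Proof.
elim: n s t u => [|n IH] s t u st /=; first exact: Nle.
by case=> U0 U1; split; [exact: IH U0|apply: IH U1].
Qed.

Lemma HK_cst n s x : N s x -> HK n s (fun=> x).
Proof.
elim: n s x => [//|n IH] s x Nx /=; split; first exact: IH.
apply: (@HK_ext n _ (fun=> 1)); first by move=> w _; rewrite /cmul /cinv /face mulVg.
by apply: IH; exact: sgp1.
Qed.

(** The three properties need a joint induction: the upper part of a product or an inverse involves
    conjugates, that is, commutators, in lower dimension. *)
Lemma HK_group n :
  [/\ (forall s u v, HK n s u -> HK n s v -> HK n s (cmul u v)),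
      (forall s u, HK n s u -> HK n s (cinv u)) &
      (forall s t u v, HK n s u -> HK n t v ->
         HK n (s + t) (fun w => [~ u w, v w]))].
Proof.
elim: n => [|n [IM IV IC]].
  split=> /= [s u v|s u|s t u v]; [exact: sgpM|exact: sgpV|exact: Ncomm].
have IJ s t u v : HK n s u -> HK n t v -> HK n s (fun w => u w ^ v w).
  move=> Hu Hv; apply: (@HK_ext n _ (cmul u (fun w => [~ u w, v w]))).
    by move=> w _; rewrite /cmul; gsimp.
  apply: IM => //; apply: (@HK_le _ _ (s + t)); first exact: leq_addr.
  exact: IC.
split=> [s u v [u0 u1] [v0 v1]|s u [u0 u1]|s t u v [u0 u1] [v0 v1]].
- split; first exact: IM u0 v0.
  apply: (HK_ext _ (IM _ _ _ (IJ _ _ _ _ u1 v0) v1)) => w _.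
  by rewrite /cmul /cinv /face; gsimp.
- split; first exact: IV u0.
  apply: (HK_ext _ (IJ _ _ _ _ (IV _ _ u1) (IV _ _ u0))) => w _.
  by rewrite /cmul /cinv /face; gsimp.
- split; first exact: IC u0 v0.
  set a := face false u in u0 u1 *; set b := cmul (cinv a) _ in u1.
  set c := face false v in v0 v1 *; set d := cmul (cinv c) _ in v1.
  have K1 := IC _ _ _ _ u1 v0; have K2 := IC _ _ _ _ u1 v1; have K3 := IC _ _ _ _ u0 v1.
  rewrite addnS in K3; rewrite addSn in K1; rewrite addSn addnS in K2.
  have {}K2 := HK_le (leqnSn _) K2.
  have Eu w : face true u w = a w * b w by rewrite /b /cmul /cinv /a; gsimp.
  have Ev w : face true v w = c w * d w by rewrite /d /cmul /cinv /c; gsimp.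
  (* [ab, cd] = [ab, d] [ab, c]^d and [ab, c] = [a, c]^b [b, c] *)
  have Kac := IC _ _ _ _ u0 v0.
  pose k1 w := [~ a w, c w]; pose k2 w := [~ b w, c w].
  have L1 : HK n (s + t).+1 (fun w => [~ k1 w, b w]).
    by have := IC _ _ _ _ Kac u1; apply: HK_le; rewrite addnS ltnS leq_addr.
  have L2 : HK n (s + t).+1 (fun w => [~ cmul k1 (fun w => [~ k1 w, b w]) w * k2 w, d w]).
    have K1' : HK n (s + t) (cmul (cmul k1 (fun w => [~ k1 w, b w])) k2).
      apply: (IM _ _ _ _ (HK_le (leqnSn _) K1)).
      by apply: (IM) => //; exact: HK_le (leqnSn _) L1.
    by have := IC _ _ _ _ K1' v1; apply: HK_le; rewrite addnS ltnS leq_addr.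
  have L3 : HK n (s + t).+1 (fun w => [~ a w * b w, d w]).
    have := IM _ _ _ (IJ _ _ _ _ K3 u1) K2; apply: HK_ext => w _.
    by rewrite /cmul; gsimp.
  have L4 := IJ _ _ _ _ L3 Kac.
  apply: (HK_ext _ (IM _ _ _ (IM _ _ _ (IM _ _ _ L4 L1) K1) L2)) => w _.
  rewrite /cmul /cinv.
  rewrite -[face false (fun w : seq bool => [~ u w, v w]) w]/(k1 w).
  rewrite -[face true (fun w : seq bool => [~ u w, v w]) w]/([~ face true u w, face true v w]).
  by rewrite Eu Ev /k1 /k2; gsimp.
Qed.

Lemma HK_mul n s u v : HK n s u -> HK n s v -> HK n s (cmul u v).
Proof. by have [+ _ _] := HK_group n; apply. Qed.

Lemma HK_inv n s u : HK n s u -> HK n s (cinv u).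
Proof. by have [_ + _] := HK_group n; apply. Qed.

Lemma HK_conj n s t u v : HK n s u -> HK n t v -> HK n s (fun w => u w ^ v w).
Proof.
move=> Hu Hv; apply: (@HK_ext n _ (cmul u (fun w => [~ u w, v w]))).
  by move=> w _; rewrite /cmul; gsimp.
apply: HK_mul => //; apply: (@HK_le _ _ (s + t)); first exact: leq_addr.
by have [_ _] := HK_group n; apply.
Qed.

End Cubes.

(** * Lattices *)

HB.mixin Record isTopGroup G of Topological G & Group G := {
  mulg_continuous : continuous (fun p : G * G => p.1 * p.2);
  invg_continuous : continuous (fun x : G => x^-1) }.

#[short(type="topGroupType")]
HB.structure Definition TopGroup := {G of Topological G & Group G & isTopGroup G}.

HB.factory Record Topological_isTopGroup G of Topological G := {
  one : G;
  inv : G -> G;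
  mul : G -> G -> G;
  mulA : associative mul;
  mul1 : left_id one mul;
  mulr1 : right_id one mul;
  mulV : left_inverse one inv mul;
  mulrV : right_inverse one inv mul;
  mul_continuous : continuous (fun p : G * G => mul p.1 p.2);
  inv_continuous : continuous inv }.

HB.builders Context G of Topological_isTopGroup G.
HB.instance Definition _ := isGroup.Build G mulA mul1 mulr1 mulV mulrV.
HB.instance Definition _ := isTopGroup.Build G mul_continuous inv_continuous.
HB.end.

(** Induction over finite covers. If [P K] failed, the sets [A] with [P (K minus A)] would form a
    proper filter, and its cluster point would contradict the local assumption. *)
Lemma compact_ind (T : topologicalType) (K : set T) (P : set T -> Prop) :
  compact K -> P set0 -> (forall A B, A `<=` B -> P B -> P A) ->
  (forall A B, P A -> P B -> P (A `|` B)) ->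
  (forall x, K x -> exists2 U, nbhs x U & P U) -> P K.
Proof.
move=> cK P0 Ps PU Ploc; apply: contrapT => nPK.
pose F : set_system T := [set A | P (K `\` A)].
have FF : ProperFilter F.
  split; first by rewrite /F /= setD0.
  split=> [|A B FA FB|A B AB FA]; first by rewrite /F /= setDT.
    by rewrite /F /= setDIr; exact: PU.
  by apply: Ps FA; exact: setDS.
have [|x [Kx Fx]] := cK F FF; first by rewrite /F /= setDv.
have [U xU PUx] := Ploc _ Kx.
have [|y [nUy Uy]] := Fx (~` U) U _ xU; last exact: nUy.
by apply: Ps PUx => z [_ /contrapT].
Qed.

Section TopGroupTheory.
Variable G : topGroupType.
Implicit Types (x y o : G) (W K : set G).

Lemma cvg_mulg (I : Type) (F : set_system I) {FF : Filter F} (f g : I -> G) a b :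
  f @ F --> a -> g @ F --> b -> (fun i => f i * g i) @ F --> a * b.
Proof.
move=> fa gb.
exact: (@cvg_comp _ _ _ (fun i => (f i, g i)) (fun p : G * G => p.1 * p.2) F
   _ (nbhs (a * b)) (cvg_pair fa gb) (@mulg_continuous G (a, b))).
Qed.

Lemma cvg_invg (I : Type) (F : set_system I) {FF : Filter F} (f : I -> G) a :
  f @ F --> a -> (fun i => (f i)^-1) @ F --> a^-1.
Proof. by move=> fa; exact: cvg_comp fa (@invg_continuous G a). Qed.

Lemma nearV (P : G -> Prop) : (\forall o \near (1 : G), P o) -> \forall o \near (1 : G), P o^-1.
Proof.
have V1 : (fun x : G => x^-1) @ (1 : G) --> (1 : G).
  by rewrite -[X in _ --> X]invg1; exact: invg_continuous.
exact: V1.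
Qed.

Lemma nearM W : nbhs (1 : G) W ->
  exists2 V, nbhs (1 : G) V & forall x y, V x -> V y -> W (x * y).
Proof.
move=> W1.
have c1 : (fun q : G * G => q.1) @ ((1 : G), (1 : G)) --> (1 : G) by exact: cvg_fst.
have c2 : (fun q : G * G => q.2) @ ((1 : G), (1 : G)) --> (1 : G) by exact: cvg_snd.
have M1 : (fun q : G * G => q.1 * q.2) @ ((1 : G), (1 : G)) --> (1 : G).
  by rewrite -[X in _ --> X](mulg1 (1 : G)); exact: cvg_mulg.
have /= := M1 _ W1.
case=> -[A B] /= [A1 B1] AB; exists (A `&` B); first exact: filterI.
by move=> x y [Ax _] [_ By]; exact: (AB (x, y)).
Qed.

(** Tube lemma: one neighbourhood of 1 serves all [k] in the compact set [K]. *)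
Lemma near_compact (f : G -> G -> G) K W : compact K ->
  continuous (fun p : G * G => f p.1 p.2) -> (forall x, f x 1 = 1) ->
  nbhs (1 : G) W -> \forall o \near (1 : G), forall k, K k -> W (f k o).
Proof.
move=> cK fc f1 W1.
have /compact_near_coveringP := cK.
move=> /(_ G (nbhs (1 : G)) (fun o k => W (f k o)) _); apply.
move=> x Kx.
have M1 : (fun p : G * G => f p.1 p.2) @ (x, (1 : G)) --> (1 : G).
  by rewrite -[X in _ --> X](f1 x); exact: (fc (x, 1)).
exact: M1 _ W1.
Qed.

Lemma continuous_comm_inv : continuous (fun p : G * G => [~ p.2^-1, p.1]).
Proof.
move=> p; rewrite /commg /conjg.
have c1 : (fun q : G * G => q.1) @ p --> p.1 by exact: cvg_fst.
have c2 : (fun q : G * G => q.2) @ p --> p.2 by exact: cvg_snd.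
do ![apply: cvg_mulg|apply: cvg_invg]; do ?[exact: c1|exact: c2].
Qed.

Lemma continuous_comm : continuous (fun p : G * G => [~ p.1, p.2]).
Proof.
move=> p; rewrite /commg /conjg.
have c1 : (fun q : G * G => q.1) @ p --> p.1 by exact: cvg_fst.
have c2 : (fun q : G * G => q.2) @ p --> p.2 by exact: cvg_snd.
do ![apply: cvg_mulg|apply: cvg_invg]; do ?[exact: c1|exact: c2].
Qed.

End TopGroupTheory.

(** * Discreteness of a lattice modulo the central series and its stability groups *)

Section Lattice.
Variable G : topGroupType.
Variables (H Gam K K1 : set G) (d : nat).
Hypothesis HH : sgp H.
Hypothesis H1 : nbhs (1 : G) H.
Hypothesis GG : sgp Gam.
Hypothesis GH : Gam `<=` H.
Hypothesis Gdisc : \forall o \near (1 : G), Gam o -> o = 1.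
Hypothesis cK : compact K.
Hypothesis HK : forall h, H h -> exists k c, [/\ K k, Gam c & h = k * c].
Hypothesis cK1 : compact K1.
Hypothesis K11 : nbhs (1 : G) K1.
Hypothesis K1H : K1 `<=` H.
Hypothesis HK1 : H `<=` genS K1.
Hypothesis Hd : H `<=` ucs H d.
Hypothesis fgG : fingen Gam.
Hypothesis nG : noetherian Gam.
Hypothesis nss : exists2 O, nbhs (1 : G) O &
  forall S, sgp S -> S `<=` O -> S `<=` [set 1].

Let Z := ucs H.
Let Zsg l : sgp (Z l) := ucs_sgp HH l.
Let ZH l : Z l `<=` H := @ucs_sub _ H HH l.
Let ZJ l x y : Z l x -> H y -> Z l (x ^ y). Proof. exact: (ucsJ HH). Qed.

Let ZR l x y : Z l x -> H y -> Z l [~ x, y].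
Proof. by move=> Zx Hy; rewrite commgEl; apply: sgpM => //; [exact: sgpV|exact: ZJ]. Qed.
Let ZRr l x y : Z l x -> H y -> Z l [~ y, x].
Proof. by move=> Zx Hy; rewrite -invgR; apply: sgpV => //; exact: ZR. Qed.

(** Absence of small subgroups in [H] modulo [Z q], stated without forming the quotient group. *)
Definition nss_mod q O := forall S : set G, sgp S -> S `<=` H ->
  (forall s, S s -> exists o z, [/\ O o, Z q z & s = o * z]) -> S `<=` Z q.

(* If p is central modulo Z_{j+1}, s |-> [p, s] is a homomorphism modulo Z_q as
   soon as [[p, s], s'] lies in Z_q, and its image is small; climb up in j. *)
Lemma nss_ucs q : exists2 O, nbhs (1 : G) O & nss_mod q O.
Proof.
elim: q => [|q [U U1 Un]].
  have [U U1 Un] := nss; exists U => // S HS SH Ss; apply: Un => // s /Ss [u [z [Uu]]].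
  by move=> ->; rewrite mulg1 => ->.
(* Intersecting with [K1] keeps [[~ p, s]] in the range where the induction on [j] in [key] applies
   again. *)
have W1 : nbhs (1 : G) (U `&` K1) by exact: filterI.
have sm := near_compact cK1 (@continuous_comm G) (@commg1 G) W1.
exists ([set o | forall k, K1 k -> (U `&` K1) [~ k, o]] `&` H); first exact: filterI.
move=> S HS SH Ss.
have key j : forall p, Z j p -> (exists w z, [/\ K1 w, Z q z & p = w * z]) ->
    forall s, S s -> Z q [~ p, s].
  elim: j => [p -> _ s _|j IH p Zp [w [z [Kw Zz pE]]]].
    by rewrite comm1g; exact: sgp1.
  have Hz := ZH Zz; have Hw := K1H Kw.
  have sml s : S s -> exists o' z', [/\ (U `&` K1) o', Z q z' & [~ p, s] = o' * z'].
    move=> Sp; have [u0 [y [[smo Ho] Zy sE]]] := Ss _ Sp.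
    exists [~ w, u0], ([~ w, u0]^-1 * [~ p, s]); split; [exact: smo| |by rewrite mulVKg].
    have Hy := ZH Zy.
    have Ha := sgpR HH Hw Ho.
    have -> : [~ w, u0]^-1 * [~ p, s] =
        [~ [~ w, u0], z] * ([~ w, y] ^ [~ w, u0] * [~ [~ w, u0], y]) ^ z * [~ z, s].
      by rewrite pE sE; gsimp.
    have Zaz : Z q [~ [~ w, u0], z] by exact: ZRr.
    have Zzs : Z q [~ z, s] by apply: ZR => //; exact: SH.
    have Zwy : Z q [~ w, y] by rewrite -invgR; apply: sgpV => //; exact: ucsR.
    have Zay : Z q [~ [~ w, u0], y] by rewrite -invgR; apply: sgpV => //; exact: ucsR.
    by apply: sgpM => //; apply: sgpM => //; apply: ZJ => //; apply: sgpM => //; exact: ZJ.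
  move=> s0 Ss0.
  have Hp := ZH Zp.
  have Hom s s' : S s -> S s' -> exists2 z, Z q z & [~ p, s * s'] = [~ p, s'] * [~ p, s] * z.
    move=> Sp Sp'; exists [~ [~ p, s], s']; last by gsimp.
    apply: IH => //; first by apply: ucsR => //; exact: SH.
    by have [u' [z' [[_ ?] ? ?]]] := sml _ Sp; exists u', z'.
  have HpS s : S s -> H [~ p, s] by move=> Ss'; apply: sgpR => //; exact: SH.
  pose S' := [set x | exists s z, [/\ S s, Z q z & x = [~ p, s] * z]].
  suff : S' `<=` Z q by apply; exists s0, 1; split=> //; [exact: sgp1|rewrite mulg1].
  apply: Un.
  - split=> [|x x' [s [z' [Sx Zz' ->]]] [s' [z'' [Sx' Zz'' ->]]]|x [s [z' [Sx Zz' ->]]]].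
    + exists 1, 1; split; [exact: sgp1|exact: sgp1|by rewrite commg1 mulg1].
    + have [u Zu E] := Hom _ _ Sx' Sx.
      exists (s' * s), (u^-1 * (z' ^ [~ p, s'] * z'')); split.
      * exact: (sgpM HS).
      * apply: sgpM => //; first exact: sgpV.
        by apply: sgpM => //; apply: ZJ => //; exact: HpS.
      * by rewrite E; gsimp.
    + have Sx' := sgpV HS Sx; have [u Zu E] := Hom _ _ Sx Sx'.
      exists s^-1, ((u * z'^-1) ^ [~ p, s]^-1); split=> //.
        apply: ZJ; first by apply: sgpM => //; exact: sgpV.
        by apply: sgpV => //; exact: HpS.
      move: E; rewrite mulgV commg1 => E.
      have -> : u = ([~ p, s^-1] * [~ p, s])^-1.
        by apply: (mulgI ([~ p, s^-1] * [~ p, s])); rewrite -E mulgV.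
      by gsimp.
  - move=> x [s [z' [Sx Zz' ->]]]; apply: sgpM => //; [exact: HpS|exact: ZH Zz'].
  - move=> x [s [z' [Sx Zz' ->]]]; have [u' [z1 [[Uu' _] Zz1 ->]]] := sml _ Sx.
    by exists u', (z1 * z'); split=> //; [exact: sgpM|rewrite mulgA].
(* By [key], [s] commutes modulo [Z q] with [K1], which generates [H]. *)
move=> s Ss0; have Hs := SH _ Ss0; split=> [//|y Hy].
rewrite -invgR; apply: sgpV => //.
suff : H `<=` [set y | H y /\ Z q [~ y, s]] by move=> /(_ _ Hy)[].
move=> {y Hy} y /HK1; move: y; apply: gen_sub.
  split=> [|x y [Hx Zx] [Hy Zy]|x [Hx Zx]] /=.
  - by split; [exact: sgp1|rewrite comm1g; exact: sgp1].
  - split; first exact: sgpM.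
    have -> : [~ x * y, s] = [~ x, s] ^ y * [~ y, s] by gsimp.
    by apply: sgpM => //; exact: ZJ.
  - have Hx' := sgpV HH Hx; split=> //.
    have -> : [~ x^-1, s] = ([~ x, s]^-1) ^ x^-1 by gsimp.
    by apply: ZJ => //; exact: sgpV.
move=> k Kk; have Hk := K1H Kk; split=> //.
apply: (key d) => //; first exact: Hd.
by exists k, 1; split=> //; [exact: sgp1|rewrite mulg1].
Qed.

Lemma nss_ucs_le n : exists2 O, nbhs (1 : G) O & forall q, (q < n)%N -> nss_mod q O.
Proof.
elim: n => [|n [U U1 Un]]; first by exists setT => //; exact: filterT.
have [U' U1' Un'] := nss_ucs n; exists (U `&` U'); first exact: filterI.
move=> q; rewrite ltnS leq_eqVlt => /orP[/eqP->|qn] S HS SH Ss.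
  by apply: Un' => // s /Ss [u [z [[]]]]; exists u, z.
by apply: (Un q qn) => // s /Ss [u [z [[]]]]; exists u, z.
Qed.

(* Gam has discrete image modulo N *)
Definition lattice_mod (N : set G) :=
  \forall o \near (1 : G), forall c, Gam c -> N (c * o) -> N c.

(* Going down in l: if c commutes with Y modulo Z_(l+1), then y |-> [c, y] is a
   homomorphism modulo Z_l which kills Gam & Y, so its image is small, hence
   trivial, modulo Z_l. *)
Lemma lattice_comm (Y KY : set G) q : sgp Y -> Y `<=` H -> compact KY ->
  (forall y, Y y -> exists k c, [/\ KY k, Gam c, Y c & y = k * c]) ->
  fingen (Gam `&` Y) -> lattice_mod (Z q) ->
  \forall o \near (1 : G), forall c, Gam c ->
    (forall y, Y y -> Z q [~ c * o, y]) -> forall y, Y y -> Z q [~ c, y].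
Proof.
move=> HY YH cKY YK [F FY GF] lq.
have [U U1 Un] := nss_ucs_le (q + d).
have fin1 (f : G) : [~ 1^-1, f] = 1 by rewrite invg1 comm1g.
have sm1 := @near_compact G (fun k o => [~ o^-1, k]) KY U cKY (@continuous_comm_inv G) fin1 U1.
have cF : compact [set` F] by apply: finite_compact; exact: finite_seq.
have sm2 := @near_compact G (fun k o => [~ o^-1, k]) _ _ cF (@continuous_comm_inv G) fin1 (nearV lq).
apply: filterS3 sm1 sm2 H1 => o so1 so2 Ho c Gc Zc.
have Hc := GH Gc; have HoV := sgpV HH Ho.
have E y : [~ c, y] = [~ c * o, y] ^ o^-1 * [~ o^-1, y] by gsimp.
(* [[~ c, f]] is in [Gam] and agrees with the small element [[~ o^-1, f]] modulo [Z q], so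
   discreteness modulo [Z q] applies. *)
have ZF f : f \in F -> Z q [~ c, f].
  move=> fF; have [Gf Yf] := FY _ fF; apply: (so2 f fF); first exact: sgpR.
  by rewrite E mulgK; apply: ZJ => //; exact: Zc.
have HR y : Y y -> H [~ c, y] by move=> Yy; apply: sgpR => //; exact: YH.
have Hom l : (forall y, Y y -> Z l.+1 [~ c, y]) -> forall y y', Y y -> Y y' ->
    exists2 z, Z l z & [~ c, y * y'] = [~ c, y'] * [~ c, y] * z.
  move=> Zl y y' Yy Yy'; exists [~ [~ c, y], y']; last by gsimp.
  by apply: ucsR; [exact: Zl|exact: YH].
have ZGY y : Gam y -> Y y -> Z q [~ c, y].
  move=> Gy Yy; suff : Gam `&` Y `<=` [set y | Y y /\ Z q [~ c, y]] by move=> /(_ y (conj Gy Yy))[].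
  move=> {y Gy Yy} y /GF; move: y; apply: gen_sub.
    split=> [|x y [Yx Zx] [Yy Zy]|x [Yx Zx]] /=.
    - by split; [exact: sgp1|rewrite commg1; exact: sgp1].
    - split; first exact: sgpM.
      have -> : [~ c, x * y] = [~ c, y] * [~ c, x] ^ y by gsimp.
      by apply: sgpM => //; apply: ZJ => //; exact: YH.
    - have YxV := sgpV HY Yx; split=> //.
      have -> : [~ c, x^-1] = ([~ c, x]^-1) ^ x^-1 by gsimp.
      by apply: ZJ; [exact: sgpV|exact: YH].
  by move=> f fF; split; [have [] := FY _ fF|exact: ZF].
(* Descent from level [q + d], which contains [H], to level [q]. *)
suff key i : (i <= d)%N -> forall y, Y y -> Z (q + (d - i)) [~ c, y].
  by move=> y /(key d (leqnn d)); rewrite subnn addn0.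
elim: i => [_ y Yy|i IH id].
  by rewrite subn0; apply: (@ucs_le _ H HH d); [exact: leq_addl|apply: Hd; exact: HR].
have {}IH := IH (ltnW id); rewrite -(subnSK id) addnS in IH.
have ltl : (q + (d - i.+1) < q + d)%N by rewrite ltn_add2l ltn_subrL (leq_trans _ id).
have lql : (q <= q + (d - i.+1))%N by exact: leq_addr.
move: (q + (d - i.+1))%N IH ltl lql => l IH ltl lql.
have {}Hom := Hom l IH.
have Zql := ucs_le HH lql.
move=> y0 Yy0.
pose S' := [set x | exists y z, [/\ Y y, Z l z & x = [~ c, y] * z]].
suff : S' `<=` Z l by apply; exists y0, 1; split=> //; [exact: sgp1|rewrite mulg1].
apply: (Un l ltl).
- split=> [|x x' [s [z' [Sx Zz' ->]]] [s' [z'' [Sx' Zz'' ->]]]|x [s [z' [Sx Zz' ->]]]].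
  + exists 1, 1; split; [exact: sgp1|exact: sgp1|by rewrite commg1 mulg1].
  + have [u Zu Eu] := Hom _ _ Sx' Sx.
    exists (s' * s), (u^-1 * (z' ^ [~ c, s'] * z'')); split.
    * exact: (sgpM HY).
    * apply: sgpM => //; first exact: sgpV.
      by apply: sgpM => //; apply: ZJ => //; exact: HR.
    * by rewrite Eu; gsimp.
  + have Sx' := sgpV HY Sx; have [u Zu Eu] := Hom _ _ Sx Sx'.
    exists s^-1, ((u * z'^-1) ^ [~ c, s]^-1); split=> //.
      apply: ZJ; first by apply: sgpM => //; exact: sgpV.
      by apply: sgpV => //; exact: HR.
    move: Eu; rewrite mulgV commg1 => Eu.
    have -> : u = ([~ c, s^-1] * [~ c, s])^-1.
      by apply: (mulgI ([~ c, s^-1] * [~ c, s])); rewrite -Eu mulgV.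
    by gsimp.
- by move=> x [s [z' [Sx Zz' ->]]]; apply: sgpM => //; [exact: HR|exact: ZH Zz'].
(* Modulo [Z l] the lattice part [b] contributes nothing, and [[~ c, k]] equals [[~ o^-1, k]], which
   is small uniformly over [KY]. *)
- move=> x [y [z' [Yy Zz' ->]]]; have [k [b [Kk Gb Yb yE]]] := YK _ Yy.
  have Yk : Y k by apply: (sgpMr HY Yb); rewrite -yE.
  have Ho' : H [~ o^-1, k] by apply: sgpR => //; exact: YH.
  have [u Zu Eu] := Hom _ _ Yk Yb.
  have Zb : Z l [~ c, b] by apply: Zql; exact: ZGY.
  have Zk : Z l ([~ c * o, k] ^ o^-1) by apply: Zql; apply: ZJ => //; exact: Zc.
  exists [~ o^-1, k], (([~ c, b] * [~ c * o, k] ^ o^-1) ^ [~ o^-1, k] * u * z'); split.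
  + exact: so1.
  + by apply: sgpM => //; apply: sgpM => //; apply: ZJ => //; exact: sgpM.
  + by rewrite yE Eu (E k); gsimp.
Qed.

(** For [k * c] in [Z q], discreteness makes the class of [c] modulo [Z q] locally constant in [k],
    so finitely many representatives [f] suffice on [K]. Then [k * c = (k * f) * (f^-1 * c)], with
    [k * f] in a compact set. *)
Lemma lattice_cocompact q : lattice_mod (Z q) -> exists2 KY, compact KY &
  forall y, Z q y -> exists k c, [/\ KY k, Gam c, Z q c & y = k * c].
Proof.
move=> lq.
pose P (U : set G) := exists2 s : seq G, [set` s] `<=` Gam &
  forall k c, U k -> H k -> Gam c -> Z q (k * c) -> exists2 f, f \in s & Z q (f^-1 * c).
have [s sG Ps] : P K.
  apply: compact_ind => //.
  - by exists [::].
  - by move=> A B AB [s sG Ps]; exists s => // k c /AB; exact: Ps.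
  - move=> A B [s sG Ps] [t tG Pt]; exists (s ++ t).
      by move=> x /=; rewrite mem_cat => /orP[/sG|/tG].
    move=> k c [Ak|Bk] Hk Gc Zkc.
      by have [f fs Zf] := Ps _ _ Ak Hk Gc Zkc; exists f => //; rewrite mem_cat fs.
    by have [f fs Zf] := Pt _ _ Bk Hk Gc Zkc; exists f => //; rewrite mem_cat fs orbT.
  - move=> x Kx.
    pose D := [set p : G * G | forall c, Gam c -> Z q (c * (p.1^-1 * p.2)) -> Z q c].
    have : nbhs (x, x) D.
      have c1 : (fun r : G * G => r.1) @ (x, x) --> x by exact: cvg_fst.
      have c2 : (fun r : G * G => r.2) @ (x, x) --> x by exact: cvg_snd.
      have M1 : (fun r : G * G => r.1^-1 * r.2) @ (x, x) --> (1 : G).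
        by rewrite -(mulVg x); apply: cvg_mulg => //; exact: cvg_invg.
      exact: M1 _ lq.
    case=> -[A B] /= [Ax Bx] AB; exists (A `&` B); first exact: filterI.
    have [[k0 [c0 [[Ak0 Bk0] Hk0 Gc0 Zk0]]]|nex] := pselect
      (exists k0 c0, [/\ (A `&` B) k0, H k0, Gam c0 & Z q (k0 * c0)]); last first.
      exists [::] => // k c ABk Hk Gc Zkc; exfalso; apply: nex; exists k, c.
      by split.
    exists [:: c0]; first by move=> c /=; rewrite inE => /eqP->.
    move=> k c [Ak Bk] Hk Gc Zkc; exists c0; first by rewrite inE.
    have Hc0 := GH Gc0; have Hc := GH Gc.
    have Gc0V := sgpV GG Gc0; have HkV := sgpV HH Hk.
    have Z1 : Z q (c * c0^-1).
      apply: (AB (k0, k)) => //=; first exact: sgpM.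
      have -> : c * c0^-1 * (k0^-1 * k) = (k * c * (k0 * c0)^-1) ^ k by gsimp.
      by apply: ZJ => //; apply: sgpM => //; exact: sgpV.
    have -> : c0^-1 * c = (c * c0^-1) ^ c0 by gsimp.
    exact: ZJ.
exists [set p.1 * p.2 | p in K `*` [set` s]].
  apply: continuous_compact; last first.
    by apply: compact_setX => //; apply: finite_compact; exact: finite_seq.
  by apply: continuous_subspaceT; exact: mulg_continuous.
move=> y Zy; have [k [c [Kk Gc yE]]] := HK (ZH Zy).
have Hk : H k by apply: (sgpMr HH (GH Gc)); rewrite -yE; exact: (ZH Zy).
have [|f fs Zf] := Ps k c Kk Hk Gc; first by rewrite -yE.
exists (k * f), (f^-1 * c); split; [by exists (k, f)|exact: (sgpM GG (sgpV GG (sG _ fs)) Gc)|exact: Zf|by rewrite yE; gsimp].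
Qed.

Lemma lattice_ucs l : lattice_mod (Z l).
Proof.
elim: l => [|l IH].
  have := nearV Gdisc; apply: filterS => o Go c Gc /= co.
  have cE : c = o^-1 by apply: (mulIg o); rewrite co mulVg.
  by rewrite cE; apply: Go; rewrite -cE.
have HGam : Gam `&` H = Gam by rewrite setIidl.
have HKH y : H y -> exists k c, [/\ K k, Gam c, H c & y = k * c].
  by move=> /HK[k [c [Kk Gc yE]]]; exists k, c; split=> //; exact: GH.
have fgGH : fingen (Gam `&` H) by rewrite HGam.
have := @lattice_comm H K l HH (fun _ h => h) cK HKH fgGH IH.
by apply: filterS => o ko c Gc [_ Zc]; split; [exact: GH|exact: ko].
Qed.

(** Each level [l <= d] needs its own neighbourhood of 1, from [lattice_comm] with [Y := Z l].
    Higher levels reduce to [l = d], since [Z d] is already [H], so a finite intersection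
    suffices. *)
Lemma lattice_stab j : lattice_mod (stab H d j).
Proof.
have lZ := lattice_ucs.
have key l : \forall o \near (1 : G), forall c, Gam c ->
    (forall y, Z l y -> Z (l - j) [~ c * o, y]) -> forall y, Z l y -> Z (l - j) [~ c, y].
  have [KY cKY ZKY] := lattice_cocompact (lZ l).
  have fgZ : fingen (Gam `&` Z l) by apply: nG; [exact: sgpI|move=> x []].
  exact: (@lattice_comm (Z l) KY _ (Zsg l) (@ZH l) cKY ZKY fgZ (lZ _)).
have keys : \forall o \near (1 : G), forall l, (l <= d)%N -> forall c, Gam c ->
    (forall y, Z l y -> Z (l - j) [~ c * o, y]) -> forall y, Z l y -> Z (l - j) [~ c, y].
  elim: d => [|n IH].
    by apply: filterS (key 0) => o ko [|//] _; exact: ko.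
  by apply: filterS2 (key n.+1) IH => o ko IHo l; rewrite leq_eqVlt => /orP[/eqP->|/IHo].
apply: filterS2 keys (lZ (d.+1 - j)) => o ko Zo c Gc [Zc Cc]; split; first exact: Zo.
move=> l y Zy; have [ld|dl] := leqP l d; first by apply: ko Zy => //; exact: Cc.
apply: (@ucs_le _ H HH (d - j)); first exact: leq_sub2r (ltnW dl).
apply: (ko d) => //; first exact: Cc.
by apply: Hd; exact: ZH Zy.
Qed.

End Lattice.

(** * Cubes close to the lattice *)

Section Split.
Variables (G : topGroupType) (N : nat -> set G) (Gam : set G) (d : nat).
Hypothesis Nsg : forall i, sgp (N i).
Hypothesis Nle : forall i j, (i <= j)%N -> N j `<=` N i.
Hypothesis Ncomm : forall i j x y, N i x -> N j y -> N (i + j) [~ x, y].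
Hypothesis Ntop : forall j, (d < j)%N -> N j `<=` [set 1].
Hypothesis GG : sgp Gam.
Hypothesis lat : forall j, \forall o \near (1 : G), forall c, Gam c -> N j (c * o) -> N j c.

Definition approx (W : set G) (x : G) := exists w c, [/\ W w, Gam c & x = w * c].

Definition split_cube W n s (c : seq bool -> G) := exists u v,
  [/\ HK N n s u, HK N n s v &
      forall w, size w = n -> [/\ W (u w), Gam (v w) & c w = u w * v w]].

(** If [c0 = u v] and [c1 = c0 b], then [u^-1 c1 v^-1] is the conjugate [v b v^-1], and [b] has one
    degree more. *)
Lemma split_facet n s (c u v : seq bool -> G) :
  HK N n.+1 s c -> HK N n s u -> HK N n s v ->
  (forall w, size w = n -> face false c w = u w * v w) ->
  HK N n s.+1 (fun w => (u w)^-1 * c (true :: w) * (v w)^-1).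
Proof.
move=> [C0 C1] Hu Hv cuv.
have Hv' := HK_inv Nsg Nle Ncomm Hv.
apply: HK_ext (HK_conj Nsg Nle Ncomm C1 Hv') => w wn.
by rewrite /cmul /cinv cuv// /face; gsimp.
Qed.

(** The lower facet is split first. What remains of the upper one is a cube of degree [s.+1], still
    close to [Gam] because [u] is small, and is split in turn; in dimension 0 this is discreteness
    modulo [N s]. *)
Lemma HK_split n s W : nbhs (1 : G) W -> exists2 V, nbhs (1 : G) V &
  forall c, HK N n s c -> (forall w, size w = n -> approx V (c w)) -> split_cube W n s c.
Proof.
elim: n s W => [|n IH] s W W1.
  exists (W `&` [set w | forall c, Gam c -> N s (c * w^-1) -> N s c]).
    by apply: filterI => //; exact: nearV (lat s).
  move=> c /= Nc /(_ [::] erefl)[w [g [[Ww lw] Gg cE]]].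
  have Ng : N s g.
    apply: (sgpVE (Nsg s)); apply: lw; first exact: sgpV.
    by rewrite -invgM -cE; exact: sgpV.
  exists (fun=> w), (fun=> g); split=> //=; first by apply: (sgpMr (Nsg s) Ng); rewrite -cE.
  by move=> t /size0nil ->.
have [W' W'1 W'W] := nearM W1.
have [V1 V11 IH1] := IH s.+1 W' W'1.
have [V' V'1 V'V] := nearM V11.
have W21 : nbhs (1 : G) (W' `&` W `&` [set w | V' w^-1]).
  by apply: filterI; [exact: filterI|exact: nearV].
have [V2 V21 IH2] := IH s _ W21.
exists (V2 `&` V'); first exact: filterI.
move=> c Hc cV; have [C0 C1] := Hc.
have [|u [v [Hu Hv uv]]] := IH2 _ C0.
  by move=> w wn; have [|x [g [[? _] ? ?]]] := cV (false :: w); [rewrite /= wn|exists x, g].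
have Hb := split_facet Hc Hu Hv (fun w wn => let: And3 _ _ e := uv w wn in e).
have [|u' [v' [Hu' Hv' uv']]] := IH1 _ Hb.
  move=> w wn; have [[_ Vu] Gv _] := uv w wn.
  have [|x [g [[_ V'x] Gg cE]]] := cV (true :: w); first by rewrite /= wn.
  exists ((u w)^-1 * x), (g * (v w)^-1); split; first exact: V'V.
    by apply: (sgpM GG) => //; exact: sgpV.
  by rewrite cE; gsimp.
exists (fun w => if w is b :: w' then (if b then u w' * u' w' else u w') else 1).
exists (fun w => if w is b :: w' then (if b then v' w' * v w' else v w') else 1).
split.
- split=> //; apply: HK_ext Hu' => w _.
  by rewrite /cmul /cinv /face; gsimp.
- split=> //; apply: (HK_ext _ (HK_conj Nsg Nle Ncomm Hv' Hv)) => w _.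
  by rewrite /cmul /cinv /face; gsimp.
- move=> [|[] w] //= /succn_inj wn; last first.
    by have [[[_ ?] _] ? ?] := uv w wn; split.
  have [[[W'u _] _] Gv _] := uv w wn; have [W'u' Gv' E] := uv' w wn.
  split; [exact: W'W|exact: sgpM|].
  have -> : c (true :: w) = u w * ((u w)^-1 * c (true :: w) * (v w)^-1) * v w by gsimp.
  by rewrite E; gsimp.
Qed.

(** Quantitative uniqueness of cube completion. Splitting off the lower facet trades a dimension for
    a degree, until the degree exceeds [d] and the cube is trivial. *)
Lemma HK_last n s W : (d < n + s)%N -> nbhs (1 : G) W -> exists2 V, nbhs (1 : G) V &
  forall c, HK N n s c -> (forall w, size w = n -> w <> nseq n true -> approx V (c w)) ->
    approx W (c (nseq n true)).
Proof.
elim: n s W => [|n IH] s W dns W1.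
  exists setT; first exact: filterT.
  move=> c /= /(Ntop dns) -> _; exists 1, 1; split; [exact: nbhs_singleton|exact: sgp1|].
  by rewrite mulg1.
have [W' W'1 W'W] := nearM W1.
have [||V1 V11 IH1] := IH s.+1 W' => //; first by rewrite addnS.
have [V' V'1 V'V] := nearM V11.
have W21 : nbhs (1 : G) (W' `&` [set w | V' w^-1]) by apply: filterI => //; exact: nearV.
have [V2 V21 IH2] := HK_split n s W21.
exists (V2 `&` V'); first exact: filterI.
move=> c Hc cV; have [C0 C1] := Hc.
have [|u [v [Hu Hv uv]]] := IH2 _ C0.
  by move=> w wn; have [||x [g [[? _] ? ?]]] := cV (false :: w); [rewrite /= wn| |exists x, g].
have Hb := split_facet Hc Hu Hv (fun w wn => let: And3 _ _ e := uv w wn in e).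
have [|x [g [W'x Gg E]]] := IH1 _ Hb.
  move=> w wn wT; have [[_ Vu] Gv _] := uv w wn.
  have [||x [g [[_ V'x] Gg cE]]] := cV (true :: w); first by rewrite /= wn.
    by move=> [].
  exists ((u w)^-1 * x), (g * (v w)^-1); split; first exact: V'V.
    by apply: (sgpM GG) => //; exact: sgpV.
  by rewrite cE; gsimp.
have [[W'u _] Gv _] := uv (nseq n true) (size_nseq _ _).
exists (u (nseq n true) * x), (g * v (nseq n true)); split; [exact: W'W|exact: sgpM|].
rewrite -[nseq n.+1 true]/(true :: nseq n true); set t := nseq n true in E *.
have -> : c (true :: t) = u t * ((u t)^-1 * c (true :: t) * (v t)^-1) * v t by gsimp.
by rewrite E; gsimp.
Qed.

End Split.

(** * Integer powers and the cubes they form *)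

Section IntPower.
Variable G : groupType.
Implicit Types (g x : G).

Definition expgz g (z : int) : G := match z with Posz m => g ^+ m | Negz m => g ^- m.+1 end.

Lemma expgzB g m p : expgz g (m%:Z - p%:Z)%R = g ^+ m * g ^- p.
Proof.
have [pm|/ltnW mp] := leqP p m.
  by rewrite subzn//= expgnFr.
have -> : (m%:Z - p%:Z)%R = (- (p - m)%N%:Z)%R by rewrite -subzn// GRing.opprB.
have -> : expgz g (- (p - m)%N%:Z)%R = g ^- (p - m).
  by case: (p - m)%N => [|q] //=; rewrite expg0 invg1.
rewrite -{2}(subnK mp) expgnDr invgM mulgA mulgV mul1g//.
Qed.

Lemma int_subE (z : int) : exists m p : nat, z = (m%:Z - p%:Z)%R.
Proof.
case: z => m; first by exists m, 0%N; rewrite GRing.subr0.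
by exists 0%N, m.+1; rewrite GRing.sub0r NegzE.
Qed.

Lemma expgzD g (y z : int) : expgz g (y + z)%R = expgz g y * expgz g z.
Proof.
have [m [p ->]] := int_subE y; have [m' [p' ->]] := int_subE z.
rewrite GRing.addrACA -GRing.opprD -!PoszD !expgzB addnC [(p + p')%N]addnC !expgnDr invgM.
have E : g ^- p * g ^+ m' = g ^+ m' * g ^- p.
  by apply: commute_sym; apply: commuteV; apply: commuteX2.
have E2 : g ^+ m' * g ^+ m = g ^+ m * g ^+ m' by rewrite -!expgnDr addnC.
have E3 : g ^- p * g ^- p' = g ^- p' * g ^- p by rewrite -!invgM -!expgnDr addnC.
by rewrite E2 !mulgA -(mulgA (g ^+ m) (g ^- p)) E !mulgA -(mulgA _ (g ^- p) (g ^- p')) ?E3 !mulgA.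
Qed.

End IntPower.

Section CubeOfPowers.
Variables (G : groupType) (N : nat -> set G).
Hypothesis Nsg : forall i, sgp (N i).
Hypothesis N01 : N 0 `<=` N 1.

Definition dotz n (m : nat -> int) (w : seq bool) : int :=
  (\sum_(i < n) if nth false w i then m i else 0)%R.

(** The difference of opposite facets is the constant [expgz g (m 0) ^ b], which has degree 1. *)
Lemma HK_powers g n m b : N 0 g -> N 0 b -> HK N n 0 (fun w => expgz g (dotz n m w) * b).
Proof.
move=> Ng Nb; elim: n m => [|n IH] m.
  by rewrite /= /dotz big_ord0 /= expg0 mul1g.
have dotS c w : dotz n.+1 m (c :: w) = ((if c then m 0%N else 0) + dotz n (m \o S) w)%R.
  by rewrite /dotz big_ord_recl.
split.
  by apply: HK_ext (IH (m \o S)) => w _; rewrite /face dotS GRing.add0r.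
apply: (@HK_ext _ _ _ _ (fun=> expgz g (m 0%N) ^ b)).
  by move=> w _; rewrite /cmul /cinv /face !dotS GRing.add0r GRing.addrC expgzD; gsimp.
apply: (HK_cst Nsg); apply: N01; apply: (sgpJ (Nsg 0)) => //.
by case: (m 0%N) => p /=; [exact: (sgpX _ (Nsg 0))|exact: (sgpV (Nsg 0) (sgpX _ (Nsg 0) Ng))].
Qed.

End CubeOfPowers.

(** * Nilmanifolds *)

Section CosetSpace.
Variables (G : topGroupType) (Gam : set G).
Hypothesis GG : sgp Gam.

Definition coset_eq (x y : G) := `[< Gam (x^-1 * y) >].

Lemma coset_eq_equiv : equiv_class_of coset_eq.
Proof.
split=> [x|x y|y x z].
- by apply/asboolP; rewrite mulVg; exact: sgp1.
- by apply: asbool_equiv_eq; split=> /(sgpV GG); rewrite invgM invgK.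
- move=> /asboolP xy /asboolP yz; apply/asboolP.
  have -> : x^-1 * z = (x^-1 * y) * (y^-1 * z) by gsimp.
  exact: sgpM.
Qed.

Definition coset_equiv := EquivRelPack coset_eq_equiv.
Definition coset_space := quotient_topology {eq_quot coset_equiv}.
HB.instance Definition _ := Topological.on coset_space.
Definition proj (x : G) : coset_space := \pi_coset_space%qT x.

Lemma projE x y : proj x = proj y <-> Gam (x^-1 * y).
Proof.
split=> [/eqmodP/asboolP//|xy]; apply/eqmodP; exact/asboolP.
Qed.

Lemma proj_surj p : exists x, p = proj x.
Proof. by exists (repr p); rewrite /proj reprK. Qed.

Lemma proj_continuous : continuous proj. Proof. exact: pi_continuous. Qed.

End CosetSpace.

Section GroupAction.
Variables (G : topGroupType) (Gam : set G).
Hypothesis GG : sgp Gam.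
Hypothesis hG : hausdorff_space G.
Hypothesis Gdisc : \forall o \near (1 : G), Gam o -> o = 1.
Local Notation X := (coset_space GG).
Local Notation pr := (@proj G Gam GG).

Lemma mull_continuous (a : G) : continuous (fun y : G => a * y).
Proof. by move=> y; apply: cvg_mulg; [exact: cvg_cst|exact: cvg_id]. Qed.

Lemma mulr_continuous (a : G) : continuous (fun y : G => y * a).
Proof. by move=> y; apply: cvg_mulg; [exact: cvg_id|exact: cvg_cst]. Qed.

Lemma nbhs_mull (a : G) (W : set G) : nbhs (1 : G) W -> nbhs a [set y | W (a^-1 * y)].
Proof.
move=> W1; have := @mull_continuous a^-1 a; rewrite /continuous_at /=.
by rewrite mulVg => /(_ _ W1).
Qed.

Lemma nbhs_mulr (a : G) (W : set G) : nbhs a W -> nbhs (1 : G) [set y | W (a * y)].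
Proof.
move=> W1; have := @mull_continuous a 1; rewrite /continuous_at /=.
by rewrite mulg1 => /(_ _ W1).
Qed.

Lemma proj_nbhs (a : G) (U : set X) : nbhs (pr a) U -> nbhs (1 : G) [set v | U (pr (a * v))].
Proof. by move=> /(@proj_continuous G Gam GG a); exact: nbhs_mulr. Qed.

Lemma proj_open (a : G) (V : set G) : nbhs (1 : G) V ->
  nbhs (pr a) [set p | exists2 v, V v & p = pr (a * v)].
Proof.
move=> V1; rewrite nbhsE /=.
exists [set p : X | exists2 v, (V^°)%classic v & p = pr (a * v)].
  split; last by exists 1; [exact: nbhs_singleton (nbhs_interior V1)|rewrite mulg1].
  rewrite /open /= /quotient_open openE => x /= [v Vv /projE xv].
  have E : (V^°)%classic (a^-1 * x * (x^-1 * (a * v))) by gsimp.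
  have nV : nbhs (a^-1 * x * (x^-1 * (a * v))) (V^°)%classic by exact: nbhs_interior.
  have c1 : (fun y => a^-1 * y * (x^-1 * (a * v))) @ x --> a^-1 * x * (x^-1 * (a * v)).
    by apply: cvg_mulg; [exact: mull_continuous|exact: cvg_cst].
  have nV' : nbhs x [set y | (V^°)%classic (a^-1 * y * (x^-1 * (a * v)))] by exact: c1.
  apply: (filterS _ nV') => y /= Vy.
  exists (a^-1 * y * (x^-1 * (a * v))) => //; apply/projE.
  have -> : y^-1 * (a * (a^-1 * y * (x^-1 * (a * v)))) = x^-1 * (a * v) by gsimp.
  by [].
by move=> p [v Vv ->]; exists v => //; exact: interior_subset.
Qed.

Lemma disc_sep : exists2 V, nbhs (1 : G) V & forall x y, V x -> V y -> Gam (x^-1 * y) -> x = y.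
Proof.
have [V V1 VP] := nearM Gdisc.
exists (V `&` [set x | V x^-1]); first by apply: filterI => //; exact: nearV.
by move=> x y [_ Vx] [Vy _] Gxy; apply/esym; apply: (mulgI x^-1); rewrite mulVg; exact: VP.
Qed.

Lemma disc_closed : closed Gam.
Proof.
move=> x cx; have [V V1 VP] := disc_sep.
have [c [Gc Vc]] := cx _ (nbhs_mull x V1).
have [->//|/eqP xc] := eqVneq x c.
have /hausdorff_accessible/accessible_closed_set1/(_ c) cc := hG.
have nx : nbhs x (~` [set c]) by apply: open_nbhs_nbhs; split; [exact: closed_openC|].
have [c' [Gc' [Vc' c'c]]] := cx _ (filterI (nbhs_mull x V1) nx).
exfalso; apply: c'c => /=; apply: (mulgI x^-1); apply/esym/VP => //.
have -> : (x^-1 * c)^-1 * (x^-1 * c') = c^-1 * c' by gsimp.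
by apply: sgpM => //; exact: sgpV.
Qed.

Lemma coset_hausdorff : hausdorff_space X.
Proof.
move=> p q; have [a ->] := proj_surj p; have [b ->] := proj_surj q => cl.
apply/projE; apply: contrapT => nG.
have nb : nbhs (a^-1 * b) (~` Gam).
  by apply: open_nbhs_nbhs; split=> //; apply: closed_openC; exact: disc_closed.
have c1 : (fun r : G * G => r.1) @ ((1 : G), (1 : G)) --> (1 : G) by exact: cvg_fst.
have c2 : (fun r : G * G => r.2) @ ((1 : G), (1 : G)) --> (1 : G) by exact: cvg_snd.
have cc : (fun r : G * G => (a * r.1)^-1 * (b * r.2)) @ ((1 : G), (1 : G)) --> a^-1 * b.
  rewrite -{2}[a]mulg1 -{2}[b]mulg1; apply: cvg_mulg; [apply: cvg_invg|];
  by apply: cvg_mulg => //; exact: cvg_cst.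
have [[V W] /= [V1 W1] VW] := cc _ nb.
have [_ [[v Vv ->] [w Ww /projE E]]] := cl _ _ (proj_open a V1) (proj_open b W1).
exact: (VW (v, w)).
Qed.

Definition act (g : G) (z : int) (p : X) : X := pr (expgz g z * repr p).

Lemma act_proj g z x : act g z (pr x) = pr (expgz g z * x).
Proof.
apply/projE; have /projE Gr : pr (repr (pr x)) = pr x by rewrite /proj reprK.
by have -> : (expgz g z * repr (pr x))^-1 * (expgz g z * x) = (repr (pr x))^-1 * x by gsimp.
Qed.

Lemma act0 g p : act g 0%R p = p.
Proof. by have [x ->] := proj_surj p; rewrite act_proj /= expg0 mul1g. Qed.

Lemma actD g y z p : act g (y + z)%R p = act g y (act g z p).
Proof. by have [x ->] := proj_surj p; rewrite !act_proj expgzD mulgA. Qed.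

Lemma act_continuous g z : continuous (act g z).
Proof.
apply/quotient_continuous; rewrite (_ : _ \o _ = pr \o (fun x => expgz g z * x)).
  move=> x; apply: continuous_comp; [exact: mull_continuous|exact: proj_continuous].
by apply/funext => x; rewrite /= -act_proj.
Qed.

End GroupAction.

(** * Compact generation and generators of the lattice *)

Section CompactGeneration.
Variables (G : topGroupType) (Gam C : set G).
Hypothesis GG : sgp Gam.
Hypothesis Gdisc : \forall o \near (1 : G), Gam o -> o = 1.
Hypothesis Gcoco : cocompact (@monoid.mul G) Gam.
Hypothesis cC : compact C.
Hypothesis C1 : nbhs (1 : G) C.

Definition covering (K : set G) := forall x, exists y c, [/\ (K^°)%classic y, Gam c & x = y * c].

Lemma compact_mulset (A B : set G) : compact A -> compact B ->
  compact [set p.1 * p.2 | p in A `*` B].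
Proof.
move=> cA cB; apply: continuous_compact; last exact: compact_setX.
by apply: continuous_subspaceT; exact: mulg_continuous.
Qed.

(** Finitely many right translates of the interior of [C] cover modulo [Gam]. [C] itself is added to
    make [K] a neighbourhood of 1. *)
Lemma compact_cover_coset : exists K, [/\ compact K, nbhs (1 : G) K & covering K].
Proof.
pose O x := [set y : G | exists c, Gam c /\ (C^°)%classic (y * c * x^-1)].
have [x|x|s sP] := Gcoco (I := G) (O := O).
- split.
    rewrite openE => y [c [Gc Cy]].
    have cc : continuous (fun y : G => y * c * x^-1).
      by move=> z; apply: cvg_mulg; [exact: mulr_continuous|exact: cvg_cst].
    have nC : nbhs (y * c * x^-1) (C^°)%classic by exact: nbhs_interior.
    have nV : nbhs y [set y | (C^°)%classic (y * c * x^-1)] by exact: cc.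
    by apply: (filterS _ nV) => z Cz; exists c.
  move=> y c [b [Gb Cy]] Gc; exists (c^-1 * b); split.
    by apply: sgpM => //; exact: sgpV.
  by have -> : y * c * (c^-1 * b) * x^-1 = y * b * x^-1 by gsimp.
- exists x, 1; split; first exact: sgp1.
  by rewrite mulg1 mulgV; exact: nbhs_singleton (nbhs_interior C1).
pose K := C `|` [set p.1 * p.2 | p in C `*` [set` s]].
have sIn x : List.In x s -> x \in s.
  by elim: (s) => //= y t IH [->|/IH]; rewrite inE ?eqxx// => ->; rewrite orbT.
exists K; split.
- apply: compactU => //; apply: compact_mulset => //.
  by apply: finite_compact; exact: finite_seq.
- by apply: filterS C1 => x; left.
- move=> x; have [y [/sIn ys [c [Gc Cx]]]] := sP x.
  exists (x * c), c^-1; split; [|exact: sgpV|by gsimp].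
  have nC : nbhs (x * c * y^-1) (C^°)%classic by exact: nbhs_interior.
  have nV : nbhs (x * c) [set z | (C^°)%classic (z * y^-1)] by exact: mulr_continuous.
  apply: (filterS _ nV) => z Cz; right; exists (z * y^-1, y) => /=; last by gsimp.
  by split=> //=; exact: interior_subset.
Qed.

(* A compact generating set of an open subgroup H makes its lattice finitely
   generated: K1 K and K1^-1 K are covered by finitely many translates K f. *)
Lemma lattice_fingen (K K1 H : set G) : compact K -> nbhs (1 : G) K -> covering K ->
  compact K1 -> K `<=` K1 -> H = genS K1 -> fingen (Gam `&` H).
Proof.
move=> cK K1' cov cK1 KK1 HE.
have HH : sgp H by rewrite HE; exact: gen_sgp.
have K1H : K1 `<=` H by rewrite HE; exact: sub_gen.
have KH x : K x -> H x by move=> /KK1/K1H.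
have fin_cover E : compact E -> E `<=` H -> exists2 F : seq G, [set` F] `<=` Gam `&` H &
    forall y, E y -> exists k f, [/\ K k, f \in F & y = k * f].
  move=> cE EH.
  pose P (U : set G) := exists2 F : seq G, [set` F] `<=` Gam `&` H &
    forall y, U y -> H y -> exists k f, [/\ K k, f \in F & y = k * f].
  suff [F FG FP] : P E by exists F => // y Ey; apply: FP => //; exact: EH.
  apply: compact_ind => //.
  - by exists [::].
  - by move=> A B AB [F FG FP]; exists F => // y /AB; exact: FP.
  - move=> A B [F FG FP] [F' FG' FP']; exists (F ++ F').
      by move=> x /=; rewrite mem_cat => /orP[/FG|/FG'].
    move=> y [Ay|By] Hy.
      by have [k [f [Kk fF ->]]] := FP y Ay Hy; exists k, f; rewrite mem_cat fF.
    by have [k [f [Kk fF ->]]] := FP' y By Hy; exists k, f; rewrite mem_cat fF orbT.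
  - move=> x Ex; have [y [c [Ky Gc xE]]] := cov x.
    have nK : nbhs (x * c^-1) (K^°)%classic by rewrite xE mulgK; exact: nbhs_interior.
    have nV : nbhs x [set z | (K^°)%classic (z * c^-1)] by exact: mulr_continuous.
    have Hc : H c.
      by apply: (sgpMl HH (KH _ (interior_subset Ky))); rewrite -xE; exact: EH.
    exists [set z | (K^°)%classic (z * c^-1)] => //.
    exists [:: c]; first by move=> z /=; rewrite inE => /eqP->.
    move=> z Kz _; exists (z * c^-1), c; split; [exact: interior_subset|by rewrite inE|by gsimp].
have cKV : compact [set x^-1 | x in K1].
  by apply: continuous_compact => //; apply: continuous_subspaceT; exact: invg_continuous.
pose E := [set p.1 * p.2 | p in (K1 `|` [set x^-1 | x in K1]) `*` K].
have [||F FG FP] := fin_cover E.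
- by apply: compact_mulset => //; exact: compactU.
- move=> _ [[x k] /= [[Kx|[y Ky <-]] Kk] <-]; apply: sgpM => //; try exact: KH.
    exact: K1H.
  by apply: sgpV => //; exact: K1H.
pose P (U : set G) := exists2 F : seq G, [set` F] `<=` Gam `&` H &
    forall y, U y -> (Gam `&` H) y -> y \in F.
have [F' FG' FP'] : P K.
  apply: compact_ind => //.
  - by exists [::].
  - by move=> A B AB [s sG sP]; exists s => // y /AB; exact: sP.
  - move=> A B [s sG sP] [t tG tP]; exists (s ++ t).
      by move=> x /=; rewrite mem_cat => /orP[/sG|/tG].
    by move=> y [Ay|By] Gy; rewrite mem_cat; [rewrite sP|rewrite (tP y)// orbT].
  - move=> x Kx; have [V V1 VP] := disc_sep Gdisc.
    have [[y [Vy Gy]]|nex] := pselect (exists y, V (x^-1 * y) /\ (Gam `&` H) y); last first.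
      exists [set y | V (x^-1 * y)]; first exact: nbhs_mull.
      by exists [::] => // y Vy Gy; exfalso; apply: nex; exists y.
    exists [set y | V (x^-1 * y)]; first exact: nbhs_mull.
    exists [:: y]; first by move=> z /=; rewrite inE => /eqP->.
    move=> z Vz [Gz _]; rewrite inE; apply/eqP/esym/(mulgI x^-1)/VP => //.
    have -> : (x^-1 * y)^-1 * (x^-1 * z) = y^-1 * z by gsimp.
    by apply: sgpM => //; apply: sgpV => //; case: Gy.
pose L := genS [set` F ++ F'].
have sL : sgp L by exact: gen_sgp.
have LG : L `<=` Gam `&` H.
  apply: gen_sub; first exact: sgpI.
  by move=> x /=; rewrite mem_cat => /orP[/FG|/FG'].
(* [B] is [K] times [L]. It is stable under left multiplication by [K1] and its inverses, so it
   contains [H]. *)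
pose B := [set x | exists k l, [/\ K k, L l & x = k * l]].
have BE x y : (K1 x \/ exists2 z, K1 z & z^-1 = x) -> B y -> B (x * y).
  move=> Kx [k [l [Kk Ll ->]]].
  have [|k' [f [Kk' fF E']]] := FP (x * k); first by exists (x, k).
  exists k', (f * l); split=> //; last by rewrite mulgA E'; gsimp.
  by apply: (sgpM sL) => //; apply: sub_gen; rewrite /= mem_cat fF.
have HB : H `<=` B.
  have sub : H `<=` [set h | forall b, B b -> B (h * b) /\ B (h^-1 * b)].
    rewrite HE; apply: gen_sub; last first.
      by move=> x Kx b Bb; split; apply: BE => //; [left|right; exists x].
    split=> [b Bb|x y Hx Hy b Bb|x Hx b Bb].
    - by rewrite invg1 mul1g.
    - have [_ Ix] := Hx _ Bb; rewrite invgM -!mulgA; split.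
        by have [+ _] := Hx _ (Hy _ Bb).1; apply.
      by have [_] := Hy _ Ix; apply.
    - by rewrite invgK; have [] := Hx _ Bb.
  move=> h /sub/(_ 1)[|+ _]; last by rewrite mulg1.
  by exists 1, 1; split; [exact: nbhs_singleton|exact: sgp1 sL|rewrite mulg1].
exists (F ++ F'); first by move=> x /=; rewrite mem_cat => /orP[/FG|/FG'].
move=> c [Gc Hc]; have [k [l [Kk Ll cE]]] := HB c Hc.
have GHs : sgp (Gam `&` H) by exact: sgpI.
have Gk : (Gam `&` H) k by apply: (sgpMr GHs (LG _ Ll)); rewrite -cE.
rewrite cE; apply: (sgpM (gen_sgp _)) => //; apply: sub_gen.
by rewrite /= mem_cat (FP' k)// orbT.
Qed.

End CompactGeneration.

(** * The closed set of dynamical cubes *)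

Section CubeClosure.
Variables (X : topologicalType) (A : int -> X -> X) (n : nat).
Hypothesis A0 : forall x, A 0%R x = x.
Hypothesis AD : forall a b x, A (a + b)%R x = A a (A b x).
Hypothesis Ac : forall z, continuous (A z).

Definition cube_closure : set (seq bool -> X) := [set y | forall U : seq bool -> set X,
  (forall w, nbhs (y w) (U w)) ->
  exists x m, forall w, size w = n -> U w (A (dotz n m w) x)].

Lemma cube_closure_cst x : cube_closure (fun=> x).
Proof.
move=> U Ux; exists x, (fun=> 0%R) => w _.
rewrite /dotz big1 ?A0; last by move=> i _; case: ifP.
exact: nbhs_singleton.
Qed.

Lemma cube_closure_closed y : (forall U : seq bool -> set X,
    (forall w, nbhs (y w) (U w)) ->
    exists2 y', cube_closure y' & forall w, size w = n -> U w (y' w)) -> cube_closure y.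
Proof.
move=> cy U Uy; have [|y' Qy' Uy'] := cy (fun w => (U w)^°)%classic.
  by move=> w; exact: nbhs_interior.
have [|x [m xm]] := Qy' (fun w => if size w == n then U w else setT).
  by move=> w; case: eqP => [/Uy'//|_]; exact: filterT.
by exists x, m => w wn; have := xm w wn; rewrite wn eqxx.
Qed.

Lemma dotz_upd i m z w : (i < n)%N ->
  dotz n (fun l => if l == i then m l + z else m l)%R w =
  (dotz n m w + (if nth false w i then z else 0))%R.
Proof.
move=> ni; rewrite /dotz (bigD1 (Ordinal ni))//= [in RHS](bigD1 (Ordinal ni))//= eqxx.
rewrite -GRing.addrA [(_ + (if nth false w i then z else 0))%R]GRing.addrC GRing.addrA.
congr (_ + _)%R; first by case: ifP => _; rewrite ?GRing.addr0.
by apply: eq_bigr => l; rewrite -val_eqE /= => /negbTE ->.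
Qed.

(** The upper face is moved by adding [z] to [m i]; the lower one by moving the base point and
    subtracting [z] from [m i], so that the upper face stays put. *)
Lemma cube_closure_face i b z y : (i < n)%N -> cube_closure y ->
  cube_closure (fun w => if nth false w i == b then A z (y w) else y w).
Proof.
move=> ni Qy U Uy.
have [|x [m xm]] := Qy (fun w => if nth false w i == b then A z @^-1` (U w) else U w).
  by move=> w; have := Uy w; case: eqP => _ //; exact: Ac.
case: b xm {Uy} => xm.
  exists x, (fun l => if l == i then m l + z else m l)%R => w wn.
  by rewrite dotz_upd// GRing.addrC AD; have := xm w wn; case: (nth false w i); rewrite ?A0.
exists (A z x), (fun l => if l == i then m l + (- z) else m l)%R => w wn.
rewrite dotz_upd// -AD; have := xm w wn; case: (nth false w i) => //=.
  by rewrite -GRing.addrA GRing.addNr GRing.addr0.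
by rewrite GRing.addr0 GRing.addrC AD.
Qed.

End CubeClosure.

(** * Recurrence in nilmanifolds *)

Section NilRecurrence.
Variables (G : topGroupType) (Gam C : set G) (d' : nat) (g : G).
Let d := d'.+1.
Hypothesis GG : sgp Gam.
Hypothesis hG : hausdorff_space G.
Hypothesis Gdisc : \forall o \near (1 : G), Gam o -> o = 1.
Hypothesis Gcoco : cocompact (@monoid.mul G) Gam.
Hypothesis cC : compact C.
Hypothesis C1 : nbhs (1 : G) C.
Hypothesis nss : exists2 W, nbhs (1 : G) W & forall S, sgp S -> S `<=` W -> S `<=` [set 1].
Hypothesis Gnil : lcs (@monoid.mul G) (@monoid.inv G) 1 d = [set 1].

Local Notation X := (coset_space GG).
Local Notation pr := (@proj G Gam GG).

(** [G] may fail to be compactly generated, so the argument runs in the open subgroup [H] generated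
    by [K] and [g]: it meets every coset of [Gam], and its lattice is finitely generated, hence
    Noetherian. *)
Lemma coset_cube_uniq (K : set G) y x : compact K -> nbhs (1 : G) K -> covering Gam K ->
  cube_closure (@act G Gam GG g) d.+1 y ->
  (forall w, size w = d.+1 -> w <> nseq d.+1 true -> y w = x) -> y (nseq d.+1 true) = x.
Proof.
move=> cK K1' cov Qy yx.
pose K1 := K `|` [set g]; pose H := genS K1.
have cK1 : compact K1 by apply: compactU => //; exact: compact_set1.
have K11 : nbhs (1 : G) K1 by apply: filterS K1' => z; left.
have HH : sgp H by exact: gen_sgp.
have K1H : K1 `<=` H by exact: sub_gen.
have KH : K `<=` H by move=> z Kz; apply: K1H; left.
have Hg : H g by apply: K1H; right.
have H1 : nbhs (1 : G) H by apply: filterS K11.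
have repH z : exists2 h, H h & pr z = pr h.
  have [h [c [Kh Gc zE]]] := cov z; exists h; first by apply: KH; exact: interior_subset.
  by apply/projE; rewrite zE invgM -mulgA mulVg mulg1; exact: sgpV.
have sGH : sgp (Gam `&` H) by exact: sgpI.
have fgG := lattice_fingen GG Gdisc cK K1' cov cK1 (@subsetUl _ _ _) (erefl H).
have nG : noetherian (Gam `&` H).
  apply: (@noetherian_nilpotent _ _ sGH d fgG) => z /rlcs_lcs; rewrite Gnil//.
have Hd : H `<=` ucs H d by exact: lcs_ucs.
have HK h : H h -> exists k c, [/\ K k, (Gam `&` H) c & h = k * c].
  move=> Hh; have [k [c [Kk Gc hE]]] := cov h; have {}Kk := interior_subset Kk.
  by exists k, c; split=> //; split=> //; apply: (sgpMl HH (KH _ Kk)); rewrite -hE.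
have Gdisc' : \forall o \near (1 : G), (Gam `&` H) o -> o = 1.
  by apply: filterS Gdisc => o Go [/Go].
have lat := lattice_stab HH H1 sGH (@subIsetr _ _ _) Gdisc' cK HK cK1 K11 K1H (@subset_refl _ H) Hd fgG nG nss.
have Nsg := stab_sgp HH d.
have Nle := fun i j => @stab_le _ H HH d i j.
have Ncomm := fun i j x y => @stab_comm _ H HH d i j x y.
have Ntop := fun j => @stab_top _ H d j.
have N0 : H `<=` stab H d 0 by exact: stab01.
have N1 : H `<=` stab H d 1 by exact: stab01.
have Q0 := N0.
apply: (coset_hausdorff hG Gdisc) => B1 B2 nB1 nB2.
have [x1 xE0] := proj_surj x; have [a Ha xE] := repH x1; rewrite -xE0 in xE.
have nW : nbhs (1 : G) [set v | B2 (pr (a * v))] by rewrite xE in nB2; exact: proj_nbhs.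
have [V V1 VP] := @HK_last G (stab H d) (Gam `&` H) d Nsg Nle Ncomm Ntop sGH lat d.+1 0
  _ (ltn_addr 0 (ltnSn d)) nW.
have VH1 : nbhs (1 : G) (V `&` H) by exact: filterI.
have [|q [m qm]] := Qy (fun w => if w == nseq d.+1 true then B1 else
   if size w == d.+1 then [set p | exists2 v, (V `&` H) v & p = pr (a * v)] else setT).
  move=> w; case: eqP => [->//|wT]; case: eqP => [wn|_]; last exact: filterT.
  by rewrite yx// xE; exact: proj_open.
have [q1 qE0] := proj_surj q; have [b Hb qE] := repH q1; rewrite -qE0 in qE.
have Haw w : H (a^-1 * (expgz g (dotz d.+1 m w) * b)).
  apply: (sgpM HH) (sgpV HH Ha) (sgpM HH _ Hb).
  by case: (dotz _ _ _) => p /=; [exact: (sgpX _ HH Hg)|exact: (sgpV HH (sgpX _ HH Hg))].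
(* Translation by [a^-1] brings [x] to the base coset. The cube of powers is then close to the
   lattice at every vertex but the last, hence also at the last. *)
have [||w [c [/= Bw [Gc _] cE]]] :=
    VP (cmul (fun=> a^-1) (fun w => expgz g (dotz d.+1 m w) * b)).
- apply: (HK_mul Nsg Nle Ncomm).
    by apply: (HK_cst Nsg); apply: N0; exact: (sgpV HH).
  by apply: (HK_powers Nsg _ d.+1 m (N0 _ Hg) (N0 _ Hb)) => z /(stab_sub HH); exact: N1.
- move=> w wn wT; have := qm w wn; rewrite (introF eqP wT) wn eqxx qE act_proj.
  move=> [v [Vv Hv] /projE E].
  exists v, (v^-1 * (a^-1 * (expgz g (dotz d.+1 m w) * b))); split=> //; last first.
    by rewrite mulVKg.
  split; last exact: (sgpM HH (sgpV HH Hv)).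
  apply: (sgpVE GG).
  have -> : (v^-1 * (a^-1 * (expgz g (dotz d.+1 m w) * b)))^-1 =
    (expgz g (dotz d.+1 m w) * b)^-1 * (a * v) by gsimp.
  exact: E.
have B1q := qm (nseq d.+1 true) (size_nseq _ _); rewrite eqxx in B1q.
exists (act g (dotz d.+1 m (nseq d.+1 true)) q); split=> //.
rewrite qE act_proj; rewrite /cmul in cE.
suff -> : pr (expgz g (dotz d.+1 m (nseq d.+1 true)) * b) = pr (a * w) by [].
apply/projE; have -> : expgz g (dotz d.+1 m (nseq d.+1 true)) * b = a * (w * c).
  by rewrite -cE mulVKg.
have -> : (a * (w * c))^-1 * (a * w) = c^-1 by gsimp.
exact: sgpV.
Qed.

Theorem nil_recurrence (V : set G) (nn : nat -> nat) :
  open V -> saturated (@monoid.mul G) Gam V -> V 1 ->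
  exists alpha, in_S d alpha /\ V (g ^+ n_sum nn alpha).
Proof.
move=> oV sV V1.
have [K [cK K1 cov]] := compact_cover_coset GG Gcoco cC C1.
have cX : compact [set: X].
  have -> : [set: X] = pr @` K.
    apply/seteqP; split=> // p _; have [x ->] := proj_surj p.
    have [k [c [Kk Gc ->]]] := cov x; exists k; first exact: interior_subset.
    by apply/projE; rewrite mulKg.
  by apply: continuous_compact => //; apply: continuous_subspaceT; exact: proj_continuous.
(* Being saturated, [V] is the preimage of a set of cosets. *)
have VE x : V x <-> V (repr (pr x)).
  have /projE Gr : pr (repr (pr x)) = pr x by rewrite /proj reprK.
  split=> Vx; last by rewrite -[x](mulVKg (repr (pr x))); exact: sV.
  rewrite -[repr _](mulVKg x); apply: sV => //.
  have -> : x^-1 * repr (pr x) = ((repr (pr x))^-1 * x)^-1 by gsimp.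
  exact: (sgpV GG).
have nV : nbhs (pr 1) [set p : X | V (repr p)].
  apply: open_nbhs_nbhs; split; last by move: V1 => /VE.
  rewrite /open /= /quotient_open (_ : _ @^-1` _ = V)//.
  by apply/seteqP; split=> x Vx; [exact: (VE x).2 Vx|exact: (VE x).1 Vx].
have [alpha [Sa]] := @gap_recurrence X (@act G Gam GG g) d' (cube_closure (@act G Gam GG g) d.+1)
  (coset_hausdorff hG Gdisc) cX (@act0 _ _ _ g) (@actD _ _ _ g) (@act_continuous _ _ _ g)
  (@cube_closure_cst _ _ _ (@act0 _ _ _ g))
  (fun i b z y => @cube_closure_face _ _ _ (@act0 _ _ _ g) (@actD _ _ _ g) (@act_continuous _ _ _ g) i b z y)
  (@cube_closure_closed _ _ _) (fun y x => @coset_cube_uniq K y x cK K1 cov) nn (pr 1) _ nV.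
by rewrite act_proj mulg1 => Va; exists alpha; split=> //; exact: (VE _).2 Va.
Qed.

End NilRecurrence.

Local Close Scope group_scope.
Local Close Scope quotient_scope.

Lemma in_S_le k k' alpha : k <= k' -> in_S k alpha -> in_S k' alpha.
Proof.
move=> kk' [fa Sa]; split=> // i /Sa[->|[j ja /andP[ij ji]]]; [by left|right].
by exists j => //; rewrite ij (leq_trans ji)// leq_add2l.
Qed.

Lemma leq_bin2 d : 0 < d -> d <= 'C(d.+1, 2).
Proof. by case: d => // d _; rewrite binS bin1 leq_addl. Qed.

Section LieTopGroup.
Variables (T : topologicalType) (mul : T -> T -> T) (inv : T -> T) (e : T).

(** An alias of [T] indexed by the Lie group hypothesis, from which its topological group structure
    is inferred. *)
Definition lie_carrier of lie_group mul inv e : Type := T.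

Variable lieT : lie_group mul inv e.
Local Notation L := (lie_carrier lieT).

Let axioms : is_group mul inv e. Proof. by case: lieT. Qed.
Let mulA : associative mul. Proof. by case: axioms. Qed.
Let mul1 : left_id e mul. Proof. by case: axioms. Qed.
Let mulr1 : right_id e mul. Proof. by case: axioms. Qed.
Let mulV : left_inverse e inv mul. Proof. by case: axioms. Qed.
Let mulrV : right_inverse e inv mul. Proof. by case: axioms. Qed.
Let mul_cont : continuous (fun p : T * T => mul p.1 p.2). Proof. by case: lieT. Qed.
Let inv_cont : continuous inv. Proof. by case: lieT. Qed.

HB.instance Definition _ := Topological.copy L T.
HB.instance Definition _ :=
  Topological_isTopGroup.Build L mulA mul1 mulr1 mulV mulrV mul_cont inv_cont.

End LieTopGroup.

(* U open nbhd of e*Gam in G/Gam  <->  V = pi^{-1}(U) open, Gam-saturated, V e;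
   and g^n Gam \in U  <->  g^n \in V. *)
Theorem theoremB (T : topologicalType) (mul : T -> T -> T) (inv : T -> T) (e : T)
  (d : nat) (Gam : set T) (g : T) (V : set T) (n : nat -> nat) :
  lie_group mul inv e ->
  nilpotent_step mul inv e d ->
  discrete_subgroup mul inv e Gam ->
  cocompact mul Gam ->
  open V -> saturated mul Gam V -> V e ->
  (forall i, (0 < i)%N -> (0 < n i)%N) ->
  exists alpha, in_S 'C(d.+1, 2) alpha /\ V (gpow mul e g (n_sum n alpha)).
Proof.
case: d => [|d'] lieT nil [GG disc] coco oV sV Ve _.
  (* For [d = 0] the group is trivial and the gap bound is 0; a singleton has no gaps. *)
  exists [:: 1%N]; split.
    split=> // i; rewrite inE => /eqP->; left.
    by rewrite big_seq1.
  suff -> : gpow mul e g (n_sum n [:: 1%N]) = e by [].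
  have : [set e] (gpow mul e g (n_sum n [:: 1%N])) by rewrite -nil.
  by [].
have [hT _ _ _ _] := lieT.
pose G : topGroupType := lie_carrier lieT.
have [K cK K1] := lie_compact_nbhs lieT.
have Gdisc : \forall o \near (e : T), Gam o -> o = e.
  have [U [oU Ue UG]] := disc e (let: And3 h _ _ := GG in h).
  have nU : nbhs e U by exact: open_nbhs_nbhs.
  apply: filterS nU => o Uo Go; have : (U `&` Gam) o by split.
  by rewrite UG.
have [alpha [Sa Va]] := @nil_recurrence G Gam K d' g GG hT Gdisc coco cK K1
  (lie_no_small_subgroup lieT) nil V n oV sV Ve.
exists alpha; split; first by apply: in_S_le Sa; exact: leq_bin2.
suff -> : gpow mul e g (n_sum n alpha) = ((g : G) ^+ n_sum n alpha)%g by [].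
by rewrite -iter_mulg_1.
Qed.
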